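(* Let $\mu,k_1,k_2>0$ be constants, and let $\rho_\pm>0$ and $u_\pm\in\mathbb{R}$ be arbitrary. Then the Riemann problem $$\begin{cases}\rho_t+(\rho u)_x=0,\\ (\rho u)_t+\left(-\dfrac{k_1}{\rho}+\rho u^2+\dfrac{k_2^2\rho^2}{2\mu}\right)_x=0,\end{cases}\qquad (\rho,u)(x,0)=(\rho_\pm,u_\pm)\ \text{ for }\ \pm x>0,$$ has a unique entropy solution, and this solution consists of shock waves, rarefaction waves and constant states.
   Context: The system is the isentropic magnetogasdynamics system with Chaplygin pressure $p=-k_1/\rho$ and magnetic field $B=k_2\rho$; $\rho>0$ is the density, $u$ the velocity, and $\mu$ the magnetic permeability. Solutions are sought in self-similar form $(\rho,u)(x,t)=(\rho,u)(\xi)$, $\xi=x/t$, with $(\rho,u)(\pm\infty)=(\rho_\pm,u_\pm)$ and $\rho>0$, composed of constant states and the following elementary waves. Put $w(\rho)=\sqrt{k_1/\rho^2+k_2^2\rho/\mu}$, $\lambda_1=u-w(\rho)$, $\lambda_2=u+w(\rho)$ (the eigenvalues of the system), and, for a left state $(\rho_l,u_l)$, $g(\rho,\rho_l)=\sqrt{\frac{1}{\rho\rho_l}\left(\frac{k_1}{\rho\rho_l}+\frac{k_2^2(\rho+\rho_l)}{2\mu}\right)}$. The states $(\rho,u)$ that can be connected to the left state $(\rho_l,u_l)$ on the right by an elementary wave are: 1-rarefaction wave $R_1$: $\xi=\lambda_1$ and $u=u_l-\int_{\rho_l}^{\rho}\frac{w(s)}{s}\,ds$, $\rho<\rho_l$.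 2-rarefaction wave $R_2$: $\xi=\lambda_2$ and $u=u_l+\int_{\rho_l}^{\rho}\frac{w(s)}{s}\,ds$, $\rho>\rho_l$. 1-shock wave $S_1$: a jump discontinuity at $\xi=\sigma=u_l-\rho\, g(\rho,\rho_l)$ with $u=u_l-g(\rho,\rho_l)(\rho-\rho_l)$, $\rho>\rho_l$. 2-shock wave $S_2$: a jump discontinuity at $\xi=\sigma=u_l+\rho\, g(\rho,\rho_l)$ with $u=u_l+g(\rho,\rho_l)(\rho-\rho_l)$, $\rho<\rho_l$. The shocks satisfy the Rankine–Hugoniot conditions for the system, and the restrictions on $\rho$ versus $\rho_l$ are the entropy (admissibility) conditions. ''Entropy solution'' means a self-similar solution of this kind all of whose discontinuities are admissible shocks $S_1$ or $S_2$. *)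

(* Defs.v *)
From Stdlib Require Import Reals List.
From Coquelicot Require Import Coquelicot.
Open Scope R_scope.

Record state := State { dens : R; vel : R }.

Definition tends_to {T : Type} (U : T -> state) (F : (T -> Prop) -> Prop)
    (l : state) : Prop :=
  filterlim (fun z => dens (U z)) F (locally (dens l)) /\
  filterlim (fun z => vel (U z)) F (locally (vel l)).

Section Chaplygin.

Variables k1 k2 mu : R.

Definition pressure (rho : R) : R := - k1 / rho.
Definition magnetic (rho : R) : R := k2 * rho.

Definition mass (s : state) : R := dens s.
Definition momentum (s : state) : R := dens s * vel s.
Definition mass_flux (s : state) : R := dens s * vel s.
Definition momentum_flux (s : state) : R :=
  pressure (dens s) + dens s * vel s ^ 2 + magnetic (dens s) ^ 2 / (2 * mu).

Definition satisfies_law (q f : state -> R) (W : R -> R -> state) (x t : R) : Prop :=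
  exists qt fx : R,
    is_derive (fun s => q (W x s)) t qt /\
    is_derive (fun y => f (W y t)) x fx /\
    qt + fx = 0.

Definition rankine_hugoniot (sigma : R) (l r : state) : Prop :=
  sigma * (mass r - mass l) = mass_flux r - mass_flux l /\
  sigma * (momentum r - momentum l) = momentum_flux r - momentum_flux l.

(* [W x t] is only constrained for t > 0.  The solution is classical off
   finitely many rays x = sigma * t; on these rays it has one-sided traces
   related by the Rankine-Hugoniot conditions, which hold trivially on the rays
   across which it is merely not differentiable (edges of rarefactions). *)
Definition riemann_solution (sm sp : state) (W : R -> R -> state) : Prop :=
  (exists D : list R,
     (forall x t, 0 < t -> ~ In (x / t) D ->
        satisfies_law mass mass_flux W x t /\
        satisfies_law momentum momentum_flux W x t) /\
     (forall sigma t, 0 < t -> In sigma D ->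
        exists l r : state,
          tends_to (fun x => W x t) (at_left (sigma * t)) l /\
          tends_to (fun x => W x t) (at_right (sigma * t)) r /\
          rankine_hugoniot sigma l r)) /\
  (forall x, x < 0 -> tends_to (fun t => W x t) (at_right 0) sm) /\
  (forall x, 0 < x -> tends_to (fun t => W x t) (at_right 0) sp).

Definition w (rho : R) : R := sqrt (k1 / rho ^ 2 + k2 ^ 2 * rho / mu).

Definition lambda1 (s : state) : R := vel s - w (dens s).
Definition lambda2 (s : state) : R := vel s + w (dens s).

Definition g (rho rhol : R) : R :=
  sqrt (1 / (rho * rhol) *
        (k1 / (rho * rhol) + k2 ^ 2 * (rho + rhol) / (2 * mu))).

Inductive wave := R1 | R2 | S1 | S2.

Definition on_curve (k : wave) (l s : state) : Prop :=
  match k with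
  | R1 => vel s = vel l - RInt (fun z => w z / z) (dens l) (dens s)
  | R2 => vel s = vel l + RInt (fun z => w z / z) (dens l) (dens s)
  | S1 => vel s = vel l - g (dens s) (dens l) * (dens s - dens l)
  | S2 => vel s = vel l + g (dens s) (dens l) * (dens s - dens l)
  end.

Definition admissible (k : wave) (l r : state) : Prop :=
  match k with
  | R1 => dens r < dens l
  | R2 => dens l < dens r
  | S1 => dens l < dens r
  | S2 => dens r < dens l
  end.

Definition connects (k : wave) (l r : state) : Prop :=
  0 < dens l /\ 0 < dens r /\ on_curve k l r /\ admissible k l r.

(* A wave occupies left_edge <= xi <= right_edge, where xi = x / t; for a shock
   both edges are the shock speed. *)
Definition left_edge (k : wave) (l r : state) : R :=
  match k with
  | R1 => lambda1 l
  | R2 => lambda2 l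
  | S1 => vel l - dens r * g (dens r) (dens l)
  | S2 => vel l + dens r * g (dens r) (dens l)
  end.

Definition right_edge (k : wave) (l r : state) : R :=
  match k with
  | R1 => lambda1 r
  | R2 => lambda2 r
  | S1 | S2 => left_edge k l r
  end.

(* The state [s] taken at [xi] inside the wave.  The value at the very location
   of a shock is left free. *)
Definition inside (k : wave) (l r : state) (xi : R) (s : state) : Prop :=
  match k with
  | R1 => xi = lambda1 s /\ on_curve R1 l s /\ dens r <= dens s <= dens l
  | R2 => xi = lambda2 s /\ on_curve R2 l s /\ dens l <= dens s <= dens r
  | S1 | S2 => True
  end.

(* On ]e, +oo[ the profile [U] starts with the constant state [l], crosses
   successively the waves of [ws], each listed with its right state, and ends
   with the constant state [last].  Intermediate constant states may have zero
   width. *)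
Fixpoint fan (U : R -> state) (last : state) (e : Rbar) (l : state)
    (ws : list (wave * state)) : Prop :=
  match ws with
  | nil => l = last /\ forall xi : R, Rbar_lt e xi -> U xi = l
  | (k, r) :: ws' =>
      connects k l r /\
      Rbar_le e (left_edge k l r) /\
      (forall xi : R, Rbar_lt e xi -> xi < left_edge k l r -> U xi = l) /\
      (forall xi : R, left_edge k l r <= xi <= right_edge k l r ->
         inside k l r xi (U xi)) /\
      fan U last (right_edge k l r) r ws'
  end.

Definition composed_of_waves (sm sp : state) (U : R -> state) : Prop :=
  exists ws : list (wave * state), fan U sp m_infty sm ws.

Definition entropy_solution (sm sp : state) (U : R -> state) : Prop :=
  (forall xi, 0 < dens (U xi)) /\
  tends_to U (Rbar_locally m_infty) sm /\
  tends_to U (Rbar_locally p_infty) sp /\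
  riemann_solution sm sp (fun x t => U (x / t)) /\
  composed_of_waves sm sp U.

End Chaplygin.

(* Main.v *)
Require Import Defs.
From Stdlib Require Import Reals List.
From Stdlib Require Import Lra Psatz Ranalysis5 IndefiniteDescription.
From Coquelicot Require Import Coquelicot.
Open Scope R_scope.

(* Through each of the two data passes a wave curve expressing the velocity of the
   middle state as a strictly monotone function of its density, decreasing for
   the 1-waves from the left state and increasing for the 2-waves to the right
   state.  Since the integral of w(s) / s diverges at the vacuum and the shock
   branch grows linearly, the curves meet exactly once.  Along a rarefaction
   d lambda / d rho is a multiple of 3 k2^2 / (2 mu w), which never vanishes, so the
   fan is obtained by inverting lambda.  The 1-waves move slower and the 2-waves
   faster than the velocity of the middle state, so the two waves fit together.
   Conversely the ordering of the edges and the Lax condition force a list of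
   waves to be, after merging adjacent rarefactions, one 1-wave followed by one
   2-wave (either may be absent), and its middle state is the intersection. *)

(** The two terms of [w] have separate duties. The Chaplygin term [k1 / rho ^ 2] dominates at low
    density and lets the rarefaction branch reach every velocity before the vacuum; the magnetic
    term makes both families genuinely nonlinear and the shock branch unbounded. For [k2 = 0] the
    fields would be linearly degenerate and the velocity jump across a shock bounded as the density
    grows, so some data would have no solution of this kind. Since [g] is symmetric, a 2-wave can be
    read backwards from its right state, and one function [wave_fun] then serves both families: the
    middle density solves one scalar equation. Uniqueness is shaped by the freedom left in [fan]: a
    rarefaction may be cut at any of its inner states, and the value at a shock is arbitrary. Hence
    lists are normalised before profiles are compared, and the comparison is made only where one
    profile is continuous. *)

Section Chaplygin.

Variables k1 k2 mu : R.
Hypothesis Hmu : 0 < mu.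
Hypothesis Hk1 : 0 < k1.
Hypothesis Hk2 : 0 < k2.

Local Notation w := (w k1 k2 mu).
Local Notation g := (g k1 k2 mu).

(** * Wave curves *)

Lemma k2_sqr_div_mu_pos : 0 < k2 ^ 2 / mu.
Proof. apply Rdiv_lt_0_compat; [apply pow_lt|]; assumption. Qed.

Lemma sound_pos (r : R) : 0 < r -> 0 < k1 / r ^ 2 + k2 ^ 2 * r / mu.
Proof.
intros Hr; pose proof k2_sqr_div_mu_pos as HB.
assert (0 < k1 / r ^ 2) by (apply Rdiv_lt_0_compat; [|apply pow_lt]; assumption).
replace (k2 ^ 2 * r / mu) with (k2 ^ 2 / mu * r) by (field; lra).
nra.
Qed.

Lemma w_pos (r : R) : 0 < r -> 0 < w r.
Proof. intros Hr; apply sqrt_lt_R0, sound_pos, Hr. Qed.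

Lemma w_sqr (r : R) : 0 < r -> w r * w r = k1 / r ^ 2 + k2 ^ 2 * r / mu.
Proof. intros Hr; apply sqrt_sqrt, Rlt_le, sound_pos, Hr. Qed.

Lemma is_derive_w (r : R) :
  0 < r -> is_derive w r ((- 2 * k1 / r ^ 3 + k2 ^ 2 / mu) / (2 * w r)).
Proof.
intros Hr; pose proof (sound_pos r Hr) as HP; pose proof (w_pos r Hr) as Hw.
unfold Defs.w in *; auto_derive.
- split; [nra|]; split; [|trivial].
  replace (k1 * / (r * (r * 1)) + k2 * (k2 * 1) * r * / mu) with (k1 / r ^ 2 + k2 ^ 2 * r / mu)
    by (simpl; unfold Rdiv; ring).
  exact HP.
- replace (k1 * / (r * (r * 1)) + k2 * (k2 * 1) * r * / mu) with (k1 / r ^ 2 + k2 ^ 2 * r / mu)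
    by (simpl; unfold Rdiv; ring).
  field; repeat split; lra.
Qed.

Lemma continuous_w_div (r : R) : 0 < r -> continuous (fun z => w z / z) r.
Proof.
intros Hr; apply (continuous_mult (K := R_AbsRing) w (fun z => / z)).
- apply (ex_derive_continuous (V := R_NormedModule)); eexists; apply is_derive_w, Hr.
- apply (ex_derive_continuous (V := R_NormedModule)).
  auto_derive; lra.
Qed.

Lemma ex_RInt_w_div (a b : R) : 0 < a -> 0 < b -> ex_RInt (fun z => w z / z) a b.
Proof.
intros Ha Hb; apply (ex_RInt_continuous (V := R_CompleteNormedModule)).
intros z Hz; apply continuous_w_div.
apply Rlt_le_trans with (2 := proj1 Hz), Rmin_glb_lt; assumption.
Qed.

(** The base point 1 is a normalisation; wave curves only involve differences. *)
Definition wprim (r : R) : R := RInt (fun z => w z / z) 1 r.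

Lemma wprim_minus (a b : R) :
  0 < a -> 0 < b -> wprim b - wprim a = RInt (fun z => w z / z) a b.
Proof.
intros Ha Hb.
assert (H : wprim a + RInt (fun z => w z / z) a b = wprim b)
  by (apply (RInt_Chasles (V := R_CompleteNormedModule)); apply ex_RInt_w_div; lra).
lra.
Qed.

Lemma is_derive_wprim (r : R) : 0 < r -> is_derive wprim r (w r / r).
Proof.
intros Hr; apply (is_derive_RInt (V := R_NormedModule) (fun z => w z / z) wprim 1 r);
  [|apply continuous_w_div, Hr].
apply (filter_imp (fun b => 0 < b)).
- intros b Hb; apply (RInt_correct (V := R_CompleteNormedModule)), ex_RInt_w_div; lra.
- apply (open_gt 0), Hr.
Qed.

Lemma incr_of_derive_pos (f df : R -> R) :
  (forall x, 0 < x -> is_derive f x (df x)) -> (forall x, 0 < x -> 0 < df x) ->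
  forall x y, 0 < x -> x < y -> f x < f y.
Proof.
intros Hf Hdf x y Hx Hxy.
apply (incr_function f 0 p_infty df); simpl; try exact I; try assumption.
- intros z Hz _; apply Hf, Hz.
- intros z Hz _; apply Hdf, Hz.
Qed.

Lemma wprim_incr (a b : R) : 0 < a -> a < b -> wprim a < wprim b.
Proof.
apply (incr_of_derive_pos wprim (fun r => w r / r) is_derive_wprim).
intros x Hx; apply Rdiv_lt_0_compat; [apply w_pos|]; exact Hx.
Qed.

(* w z / z >= sqrt k1 / z ^ 2, so the integral diverges at the vacuum. *)
Lemma wprim_le_near_0 (r : R) : 0 < r <= 1 -> wprim r <= sqrt k1 * (1 - 1 / r).
Proof.
intros [Hr Hr1].
(* Adding [sqrt k1 / r] turns the comparison of integrands into monotonicity of one function, whose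
   value at 1 is [sqrt k1]. *)
assert (Hd : forall x, 0 < x ->
  is_derive (fun r => wprim r + sqrt k1 / r) x (w x / x - sqrt k1 / x ^ 2)).
{ intros x Hx.
  apply (is_derive_plus (V := R_NormedModule) wprim (fun r => sqrt k1 / r) x
    (w x / x) (- (sqrt k1 / x ^ 2))).
  - apply is_derive_wprim, Hx.
  - auto_derive; [lra|field; lra]. }
assert (Hp : forall x, 0 < x -> 0 < w x / x - sqrt k1 / x ^ 2).
{ intros x Hx.
  assert (Hs : sqrt k1 / x < w x).
  { assert (H : sqrt (k1 / x ^ 2) = sqrt k1 / x).
    { rewrite sqrt_div_alt by (apply pow_lt; exact Hx).
      rewrite <- Rsqr_pow2, sqrt_Rsqr by lra; reflexivity. }
    rewrite <- H; apply sqrt_lt_1_alt; split.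
    - apply Rlt_le, Rdiv_lt_0_compat; [|apply pow_lt]; assumption.
    - pose proof k2_sqr_div_mu_pos.
      replace (k2 ^ 2 * x / mu) with (k2 ^ 2 / mu * x) by (field; lra); nra. }
  replace (sqrt k1 / x ^ 2) with (sqrt k1 / x * / x) by (field; lra).
  assert (0 < / x) by (apply Rinv_0_lt_compat, Hx).
  unfold Rdiv at 1; nra. }
assert (H1 : wprim 1 = 0) by apply (RInt_point (V := R_CompleteNormedModule)).
destruct (Req_dec r 1) as [->|Hne]; [lra|].
pose proof (incr_of_derive_pos _ _ Hd Hp r 1 Hr) as H; cbv beta in H.
rewrite H1 in H; unfold Rdiv in *; rewrite Rinv_1 in H.
assert (r < 1) by lra; specialize (H ltac:(lra)); lra.
Qed.

(** * Shock branch: relative speed and velocity jump *)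

Lemma g_sqr_pos (a b : R) : 0 < a -> 0 < b ->
  0 < 1 / (a * b) * (k1 / (a * b) + k2 ^ 2 * (a + b) / (2 * mu)).
Proof.
intros Ha Hb; assert (Hab : 0 < a * b) by nra; pose proof (pow_lt k2 2 Hk2).
apply Rmult_lt_0_compat; [apply Rdiv_lt_0_compat; lra|].
apply Rplus_lt_0_compat; apply Rdiv_lt_0_compat; nra.
Qed.

Lemma g_pos (a b : R) : 0 < a -> 0 < b -> 0 < g a b.
Proof. intros Ha Hb; apply sqrt_lt_R0, g_sqr_pos; assumption. Qed.

Lemma g_sqr (a b : R) : 0 < a -> 0 < b ->
  g a b * g a b = 1 / (a * b) * (k1 / (a * b) + k2 ^ 2 * (a + b) / (2 * mu)).
Proof. intros Ha Hb; apply sqrt_sqrt, Rlt_le, g_sqr_pos; assumption. Qed.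

Lemma g_sym (a b : R) : g a b = g b a.
Proof. unfold Defs.g; rewrite (Rmult_comm a b), (Rplus_comm a b); reflexivity. Qed.

Lemma sqr_lt_reg (x y : R) : 0 < y -> x * x < y * y -> x < y.
Proof. intros; nra. Qed.

(** [a * g a b] is the speed of the shock relative to the fluid of density [b]. While [g a b]
    decreases in [a], the square of this product is a sum of terms nondecreasing in [a]. *)
Lemma mul_g_sqr (a b : R) : 0 < a -> 0 < b ->
  (a * g a b) * (a * g a b) = k1 / b ^ 2 + k2 ^ 2 / mu * (a + a ^ 2 / b) / 2.
Proof.
intros Ha Hb.
replace (a * g a b * (a * g a b)) with (a ^ 2 * (g a b * g a b)) by ring.
rewrite g_sqr by assumption; field; lra.
Qed.

Lemma mul_g_incr (a a' b : R) : 0 < b -> 0 < a -> a < a' -> a * g a b < a' * g a' b.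
Proof.
intros Hb Ha Haa.
apply sqr_lt_reg; [apply Rmult_lt_0_compat; [|apply g_pos]; lra|].
rewrite !mul_g_sqr by lra.
pose proof k2_sqr_div_mu_pos.
assert (a ^ 2 / b < a' ^ 2 / b)
  by (apply Rmult_lt_compat_r; [apply Rinv_0_lt_compat; lra|nra]).
unfold Rdiv at 3 6; nra.
Qed.

(** Zero-strength limit: the relative shock speed becomes the sound speed. Together with
    [mul_g_incr] this yields both Lax inequalities. *)
Lemma mul_g_diag (a : R) : 0 < a -> a * g a a = w a.
Proof.
intros Ha.
assert (H : a * g a a * (a * g a a) = w a * w a).
{ rewrite mul_g_sqr, w_sqr by exact Ha; field; lra. }
assert (0 < a * g a a) by (apply Rmult_lt_0_compat; [|apply g_pos]; exact Ha).
pose proof (w_pos a Ha); nra.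
Qed.

Lemma w_lt_mul_g (a b : R) : 0 < b -> b < a -> w b < a * g a b.
Proof.
intros Hb Hab; rewrite <- mul_g_diag by exact Hb; apply mul_g_incr; assumption.
Qed.

Lemma mul_g_lt_w (a b : R) : 0 < a -> a < b -> a * g a b < w b.
Proof.
intros Ha Hab; rewrite <- mul_g_diag by lra; apply mul_g_incr; lra.
Qed.

Definition hugoniot (a b : R) : R := g a b * (a - b).

Lemma hugoniot_incr (a a' b : R) :
  0 < b -> b <= a -> a < a' -> hugoniot a b < hugoniot a' b.
Proof.
intros Hb Hba Haa; unfold hugoniot.
(* [g a b] decreases while [a - b] increases; moving a factor [a] across leaves two increasing
   factors, nonnegative for [b <= a]. *)
replace (g a b * (a - b)) with ((a * g a b) * (1 - b / a)) by (field; lra).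
replace (g a' b * (a' - b)) with ((a' * g a' b) * (1 - b / a')) by (field; lra).
pose proof (mul_g_incr a a' b Hb ltac:(lra) Haa).
pose proof (g_pos a b ltac:(lra) Hb); assert (0 < a * g a b) by (apply Rmult_lt_0_compat; lra).
assert (b / a' < b / a).
{ apply Rmult_lt_compat_l; [lra|apply Rinv_lt_contravar; nra]. }
assert (b / a <= 1) by (apply Rle_div_l; lra).
nra.
Qed.

(** The magnetic term of [g a b ^ 2] is [k2 ^ 2 / (2 * mu) * (1 / a + 1 / b)]; keeping only its part
    in [1 / b] gives a slope independent of [a]. *)
Lemma hugoniot_ge_linear (a b : R) : 0 < b -> b <= a ->
  sqrt (k2 ^ 2 / mu / (2 * b)) * (a - b) <= hugoniot a b.
Proof.
intros Hb Hba; apply Rmult_le_compat_r; [lra|].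
pose proof k2_sqr_div_mu_pos as HB.
apply sqrt_le_1_alt.
apply Rminus_le_0.
replace (1 / (a * b) * (k1 / (a * b) + k2 ^ 2 * (a + b) / (2 * mu)) - k2 ^ 2 / mu / (2 * b))
  with (k1 / (a * b) ^ 2 + k2 ^ 2 / mu / (2 * a)) by (field; lra).
assert (0 < a * b) by nra.
apply Rlt_le, Rplus_lt_0_compat; apply Rdiv_lt_0_compat; try lra.
apply pow_lt; lra.
Qed.

Lemma continuous_g (b a : R) : 0 < b -> 0 < a -> continuous (fun a => g a b) a.
Proof.
intros Hb Ha; unfold Defs.g.
apply (continuous_comp (fun a => 1 / (a * b) * (k1 / (a * b) + k2 ^ 2 * (a + b) / (2 * mu))) sqrt).
- apply (ex_derive_continuous (V := R_NormedModule)); auto_derive.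
  assert (a * b <> 0) by nra; tauto.
- apply continuous_sqrt.
Qed.

(* [b] is the density of the outer state of the wave: the left one for the first
   family, the right one for the second. *)
Definition wave_fun (a b : R) : R :=
  wprim (Rmin a b) - wprim b + hugoniot (Rmax a b) b.

Lemma wave_fun_rarefaction (a b : R) : a <= b -> wave_fun a b = wprim a - wprim b.
Proof.
intros Hab; unfold wave_fun, hugoniot; rewrite Rmin_left, Rmax_right by exact Hab; ring.
Qed.

Lemma wave_fun_shock (a b : R) : b <= a -> wave_fun a b = g a b * (a - b).
Proof.
intros Hab; unfold wave_fun, hugoniot; rewrite Rmin_right, Rmax_left by exact Hab; ring.
Qed.

Lemma wave_fun_incr (a a' b : R) :
  0 < b -> 0 < a -> a < a' -> wave_fun a b < wave_fun a' b.
Proof.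
intros Hb Ha Haa.
assert (Hs : forall x y, b <= x -> x < y -> wave_fun x b < wave_fun y b).
{ intros x y Hx Hy; rewrite !wave_fun_shock by lra; apply hugoniot_incr; lra. }
assert (Hr : forall x y, 0 < x -> y <= b -> x < y -> wave_fun x b < wave_fun y b).
{ intros x y Hx Hy Hxy; rewrite !wave_fun_rarefaction by lra.
  pose proof (wprim_incr x y Hx Hxy); lra. }
destruct (Rle_lt_dec a' b) as [H|H]; [apply Hr; assumption|].
destruct (Rlt_le_dec a b) as [H'|H']; [|apply Hs; assumption].
apply Rlt_trans with (wave_fun b b); [apply Hr|apply Hs]; lra.
Qed.

Lemma continuous_Rmin_r (b x : R) : continuous (fun a => Rmin a b) x.
Proof.
apply (continuous_ext (fun a => (a + b - Rabs (a - b)) / 2)).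
- intros a; unfold Rmin, Rabs; destruct (Rle_dec a b), (Rcase_abs (a - b)); lra.
- apply (continuous_mult (K := R_AbsRing) (fun a => a + b - Rabs (a - b)) (fun _ => / 2));
    [|apply continuous_const].
  apply (continuous_minus (V := R_NormedModule) (fun a => a + b) (fun a => Rabs (a - b))).
  + apply (ex_derive_continuous (V := R_NormedModule)); auto_derive; trivial.
  + apply (continuous_comp (fun a => a - b) Rabs); [|apply continuous_Rabs].
    apply (ex_derive_continuous (V := R_NormedModule)); auto_derive; trivial.
Qed.

Lemma continuous_Rmax_r (b x : R) : continuous (fun a => Rmax a b) x.
Proof.
apply (continuous_ext (fun a => - Rmin (- a) (- b))).
- intros a; unfold Rmin, Rmax; destruct (Rle_dec a b), (Rle_dec (- a) (- b)); lra.
- apply (continuous_opp (V := R_NormedModule) (fun a => Rmin (- a) (- b))).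
  apply (continuous_comp Ropp (fun a => Rmin a (- b))); [|apply continuous_Rmin_r].
  apply (continuous_opp (V := R_NormedModule) (fun a => a)), continuous_id.
Qed.

(** Clamping with [Rmin] and [Rmax], rather than testing [a <= b], makes continuity at the junction
    [a = b] a matter of composition. *)
Lemma continuous_wave_fun (b a : R) :
  0 < b -> 0 < a -> continuous (fun a => wave_fun a b) a.
Proof.
intros Hb Ha; unfold wave_fun.
apply (continuous_plus (V := R_NormedModule)
  (fun a => wprim (Rmin a b) - wprim b) (fun a => hugoniot (Rmax a b) b)).
- apply (continuous_minus (V := R_NormedModule) (fun a => wprim (Rmin a b)) (fun _ => wprim b));
    [|apply continuous_const].
  apply (continuous_comp (fun a => Rmin a b) wprim); [apply continuous_Rmin_r|].
  apply (ex_derive_continuous (V := R_NormedModule)); eexists; apply is_derive_wprim.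
  apply Rmin_glb_lt; assumption.
- apply (continuous_comp (fun a => Rmax a b) (fun a => hugoniot a b)); [apply continuous_Rmax_r|].
  apply (continuous_mult (K := R_AbsRing) (fun a => g a b) (fun a => a - b)).
  + apply continuous_g; [exact Hb|].
    apply Rlt_le_trans with (1 := Hb), Rmax_r.
  + apply (ex_derive_continuous (V := R_NormedModule)); auto_derive; trivial.
Qed.

(** Intermediate value theorem between a density near the vacuum, where both terms are on the
    rarefaction branch, and one above [b] and [c], where both are on the shock branch. *)
Lemma wave_fun_pair_surj (b c y : R) : 0 < b -> 0 < c ->
  exists a, 0 < a /\ wave_fun a b + wave_fun a c = y.
Proof.
intros Hb Hc.
set (F a := wave_fun a b + wave_fun a c).
assert (Hinc : forall x z, 0 < x -> x < z -> F x < F z).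
{ intros x z Hx Hz; unfold F.
  pose proof (wave_fun_incr x z b Hb Hx Hz); pose proof (wave_fun_incr x z c Hc Hx Hz); lra. }
assert (Hlo : exists a, 0 < a /\ F a < y).
{ set (m := Rmin 1 (Rmin b c)).
  assert (Hm : 0 < m) by (repeat apply Rmin_glb_lt; lra).
  assert (m <= 1 /\ m <= b /\ m <= c) as [Hm1 [Hmb Hmc]].
  { unfold m; pose proof (Rmin_l 1 (Rmin b c)); pose proof (Rmin_r 1 (Rmin b c));
    pose proof (Rmin_l b c); pose proof (Rmin_r b c); lra. }
  pose proof (sqrt_lt_R0 k1 Hk1) as Hs.
  (* The summand [1 / m] puts [/ K] below [b], [c] and 1, so that both terms are rarefactions and
     the vacuum estimate applies; the first summand pushes [sqrt k1 * (1 - K)] below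
     [- Rabs (wprim b + wprim c + y)]. *)
  set (K := Rabs (wprim b + wprim c + y) / sqrt k1 + 1 / m + 1).
  assert (HK0 : 0 <= Rabs (wprim b + wprim c + y) / sqrt k1)
    by (apply Rdiv_le_0_compat; [apply Rabs_pos|exact Hs]).
  assert (H1m : 1 <= 1 / m) by (apply Rle_div_r; lra).
  assert (HK : 0 < K) by (unfold K; lra).
  exists (/ K); split; [apply Rinv_0_lt_compat, HK|].
  assert (/ K <= m).
  { replace m with (/ (1 / m)) by (field; lra).
    apply Rinv_le_contravar; unfold K; lra. }
  assert (0 < / K) by (apply Rinv_0_lt_compat, HK).
  pose proof (wprim_le_near_0 (/ K) ltac:(lra)) as HW.
  replace (1 / / K) with K in HW by (field; lra).
  unfold F; rewrite !wave_fun_rarefaction by lra.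
  assert (sqrt k1 * (1 - K) = - Rabs (wprim b + wprim c + y) - sqrt k1 / m)
    by (unfold K; field; lra).
  assert (0 < sqrt k1 / m) by (apply Rdiv_lt_0_compat; lra).
  pose proof (Rle_abs (- (wprim b + wprim c + y))) as HA; rewrite Rabs_Ropp in HA.
  pose proof (Rabs_pos (wprim b + wprim c + y)); lra. }
assert (Hhi : exists a, 0 < a /\ y < F a).
{ set (m := Rmax b c).
  assert (b <= m) by apply Rmax_l; assert (c <= m) by apply Rmax_r.
  set (s := sqrt (k2 ^ 2 / mu / (2 * b))).
  assert (Hs : 0 < s).
  { apply sqrt_lt_R0, Rdiv_lt_0_compat; [apply k2_sqr_div_mu_pos|lra]. }
  (* The term in [b] alone exceeds [y], by the linear bound of slope [s]; the term in [c] is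
     nonnegative. *)
  exists (m + (Rabs y + 1) / s).
  assert (Ha : 0 < (Rabs y + 1) / s)
    by (apply Rdiv_lt_0_compat; [pose proof (Rabs_pos y); lra|exact Hs]).
  split; [lra|unfold F].
  rewrite !wave_fun_shock by lra.
  pose proof (hugoniot_ge_linear (m + (Rabs y + 1) / s) b Hb ltac:(lra)) as H1.
  pose proof (g_pos (m + (Rabs y + 1) / s) c ltac:(lra) Hc).
  unfold hugoniot in H1; fold s in H1.
  assert (s * ((Rabs y + 1) / s) = Rabs y + 1) by (field; lra).
  pose proof (Rle_abs y); nra. }
destruct Hlo as [lo [Hlo HFlo]], Hhi as [hi [Hhi HFhi]].
assert (Hlt : lo < hi).
{ destruct (Rtotal_order lo hi) as [H|[->|H]]; [exact H|lra|].
  pose proof (Hinc hi lo Hhi H); lra. }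
destruct (IVT_interv (fun a => F a - y) lo hi) as [a [Ha HFa]]; try lra.
- intros a Ha; apply continuity_pt_filterlim.
  apply (continuous_minus (V := R_NormedModule) F (fun _ => y)); [|apply continuous_const].
  apply (continuous_plus (V := R_NormedModule) (fun a => wave_fun a b) (fun a => wave_fun a c));
    apply continuous_wave_fun; lra.
- exists a; split; [lra|]; fold (F a); lra.
Qed.

Lemma wave_fun_pair_inj (b c x y : R) : 0 < b -> 0 < c -> 0 < x -> 0 < y ->
  wave_fun x b + wave_fun x c = wave_fun y b + wave_fun y c -> x = y.
Proof.
intros Hb Hc Hx Hy H.
destruct (Rtotal_order x y) as [H'|[H'|H']]; [exfalso| exact H'|exfalso].
- pose proof (wave_fun_incr x y b Hb Hx H'); pose proof (wave_fun_incr x y c Hc Hx H'); lra.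
- pose proof (wave_fun_incr y x b Hb Hy H'); pose proof (wave_fun_incr y x c Hc Hy H'); lra.
Qed.

(* In a rarefaction the characteristic speed is a constant plus or minus
   [char_fun rho]. *)
Definition char_fun (r : R) : R := wprim r + w r.

(** Over the common denominator [2 * w r], the contributions [2 * k1 / r ^ 3] of [w r / r] and of
    the derivative of [w] cancel, and the magnetic ones add up as 2 + 1. *)
Lemma is_derive_char_fun (r : R) :
  0 < r -> is_derive char_fun r (3 * (k2 ^ 2 / mu) / (2 * w r)).
Proof.
intros Hr; pose proof (w_pos r Hr) as Hw; pose proof (w_sqr r Hr) as Hw2.
replace (3 * (k2 ^ 2 / mu) / (2 * w r))
  with (plus (w r / r) ((- 2 * k1 / r ^ 3 + k2 ^ 2 / mu) / (2 * w r))).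
- apply (is_derive_plus (V := R_NormedModule)); [apply is_derive_wprim|apply is_derive_w]; exact Hr.
- unfold plus; simpl.
  replace (w r / r) with (2 * (w r * w r) / r / (2 * w r)) by (field; lra).
  rewrite Hw2; field; lra.
Qed.

Lemma char_fun_derive_pos (r : R) : 0 < r -> 0 < 3 * (k2 ^ 2 / mu) / (2 * w r).
Proof.
intros Hr; pose proof k2_sqr_div_mu_pos; pose proof (w_pos r Hr).
apply Rdiv_lt_0_compat; lra.
Qed.

Lemma char_fun_incr (a b : R) : 0 < a -> a < b -> char_fun a < char_fun b.
Proof.
exact (incr_of_derive_pos _ _ is_derive_char_fun char_fun_derive_pos a b).
Qed.

(** * Inverting the characteristic speed *)

(** The inverse is extended by constants so that one formula describes a rarefaction together with
    its two adjacent constant states, continuously across the edges. *)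
Lemma derive_pos_clamped_inverse (f df : R -> R) (a b : R) :
  (forall x, 0 < x -> is_derive f x (df x)) -> (forall x, 0 < x -> 0 < df x) ->
  0 < a <= b ->
  exists k : R -> R,
    (forall y, a <= k y <= b) /\
    (forall y, y <= f a -> k y = a) /\
    (forall y, f b <= y -> k y = b) /\
    (forall y, f a <= y <= f b -> f (k y) = y) /\
    (forall y, continuous k y) /\
    (forall y, f a < y < f b -> is_derive k y (/ df (k y))).
Proof.
intros Hf Hdf [Ha Hab].
pose proof (incr_of_derive_pos f df Hf Hdf) as Hinc.
assert (Hincb : forall x z, 0 < x -> 0 < z -> f x <= f z -> x <= z).
{ intros x z Hx Hz H; destruct (Rle_lt_dec x z) as [H'|H']; [exact H'|].
  pose proof (Hinc z x Hz H'); lra. }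
assert (Hcont : forall x, 0 < x -> continuous f x).
{ intros x Hx; apply (ex_derive_continuous (V := R_NormedModule)); exists (df x); apply Hf, Hx. }
assert (Hfab : f a <= f b).
{ destruct Hab as [H| ->]; [apply Rlt_le, Hinc; assumption|lra]. }
set (cl y := Rmax (f a) (Rmin (f b) y)).
assert (Hcl : forall y, f a <= cl y <= f b).
{ intros y; split; [apply Rmax_l|apply Rmax_lub; [exact Hfab|apply Rmin_l]]. }
(* [cl] is nondecreasing and 1-Lipschitz; continuity of the inverse rests on this. *)
assert (Hcll : forall y z, y <= z -> cl y <= cl z <= cl y + (z - y)).
{ intros y z H; unfold cl, Rmax, Rmin.
  destruct (Rle_dec (f b) y), (Rle_dec (f b) z);
  repeat match goal with |- context [Rle_dec ?u ?v] => destruct (Rle_dec u v) end; lra. }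
assert (Hex : forall y, exists x, a <= x <= b /\ f x = cl y).
{ intros y; specialize (Hcl y).
  destruct (Req_dec (f a) (cl y)) as [H|H]; [exists a; split; [lra|exact H]|].
  destruct (Req_dec (f b) (cl y)) as [H'|H']; [exists b; split; [lra|exact H']|].
  destruct (IVT_interv (fun x => f x - cl y) a b) as [x [Hx Hfx]]; try lra.
  - intros x Hx; apply continuity_pt_filterlim.
    apply (continuous_minus (V := R_NormedModule) f (fun _ => cl y));
      [apply Hcont; lra|apply continuous_const].
  - destruct Hab as [Hab| ->]; lra.
  - exists x; split; [exact Hx|lra]. }
destruct (functional_choice _ Hex) as [k Hk].
assert (Hkr : forall y, a <= k y <= b) by (intros y; apply Hk).
assert (Hfk : forall y, f (k y) = cl y) by (intros y; apply Hk).
assert (Hid : forall y, f a <= y <= f b -> f (k y) = y).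
{ intros y Hy; rewrite Hfk; unfold cl; rewrite Rmin_right, Rmax_right; lra. }
assert (Hlo : forall y, y <= f a -> k y = a).
{ intros y Hy; apply Rle_antisym; [|apply Hkr].
  apply Hincb; [specialize (Hkr y); lra|exact Ha|].
  rewrite Hfk; unfold cl; apply Rmax_lub; [lra|].
  apply Rle_trans with (1 := Rmin_r _ _), Hy. }
assert (Hhi : forall y, f b <= y -> k y = b).
{ intros y Hy; apply Rle_antisym; [apply Hkr|].
  apply Hincb; [lra|specialize (Hkr y); lra|].
  rewrite Hfk; unfold cl; rewrite Rmin_left by exact Hy; apply Rmax_r. }
assert (Hkc : forall y, continuous k y).
{ intros y; apply filterlim_locally; intros eps.
  (* If [k z] reached [k y + eps], then [cl z] would be at least [f (k y + eps)], whereas [cl] moves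
     no faster than its argument; the gap serves as radius. When [k y + eps] exceeds [b], the bound
     [k z <= b] suffices. *)
  assert (Hup : exists d, 0 < d /\ forall z, z < y + d -> k z < k y + eps).
  { pose proof (cond_pos eps) as Heps.
    destruct (Rlt_le_dec b (k y + eps)) as [H|H].
    - exists 1; split; [lra|]; intros z _; specialize (Hkr z); lra.
    - exists (f (k y + eps) - cl y); split.
      + rewrite <- Hfk; pose proof (Hinc (k y) (k y + eps)); specialize (Hkr y); lra.
      + intros z Hz; apply Rnot_le_lt; intros Hle.
        assert (Hfz : f (k y + eps) <= f (k z)).
        { specialize (Hkr y); destruct Hle as [Hle| ->]; [apply Rlt_le, Hinc; lra|lra]. }
        rewrite Hfk in Hfz.
        destruct (Rle_lt_dec y z) as [Hyz|Hyz].
        * pose proof (Hcll y z Hyz); lra.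
        * pose proof (Hcll z y ltac:(lra)).
          pose proof (Hinc (k y) (k y + eps) ltac:(specialize (Hkr y); lra) ltac:(lra)) as H2.
          rewrite Hfk in H2; lra. }
  assert (Hdn : exists d, 0 < d /\ forall z, y - d < z -> k y - eps < k z).
  { pose proof (cond_pos eps) as Heps.
    destruct (Rlt_le_dec (k y - eps) a) as [H|H].
    - exists 1; split; [lra|]; intros z _; specialize (Hkr z); lra.
    - pose proof (Hinc (k y - eps) (k y) ltac:(lra) ltac:(lra)) as H2; rewrite Hfk in H2.
      exists (cl y - f (k y - eps)); split; [lra|].
      intros z Hz; apply Rnot_le_lt; intros Hle.
      assert (Hfz : f (k z) <= f (k y - eps)).
      { specialize (Hkr z); destruct Hle as [Hle| <-]; [apply Rlt_le, Hinc; lra|lra]. }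
      rewrite Hfk in Hfz.
      destruct (Rle_lt_dec z y) as [Hyz|Hyz].
      + pose proof (Hcll z y Hyz); lra.
      + pose proof (Hcll y z ltac:(lra)); lra. }
  destruct Hup as [d1 [Hd1 H1]], Hdn as [d2 [Hd2 H2]].
  exists (mkposreal (Rmin d1 d2) (Rmin_glb_lt _ _ _ Hd1 Hd2)).
  intros z Hz; apply Rabs_lt_between' in Hz; simpl in Hz.
  apply Rabs_lt_between'.
  pose proof (Rmin_l d1 d2); pose proof (Rmin_r d1 d2).
  split; [apply H2|apply H1]; lra. }
exists k; do 5 (split; [assumption|]).
intros y Hy; apply is_derive_Reals.
assert (Hka : k (f a) = a) by (apply Hlo; lra).
assert (Hkb : k (f b) = b) by (apply Hhi; lra).
assert (Prf : forall x, k (f a) <= x <= k (f b) -> derivable_pt f x).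
{ intros x Hx; exists (df x); apply is_derive_Reals, Hf; lra. }
assert (Hin : k (f a) <= k y <= k (f b)) by (rewrite Hka, Hkb; apply Hkr).
assert (Hdpt : derive_pt f (k y) (Prf (k y) Hin) = df (k y)).
{ apply derive_pt_eq_0, is_derive_Reals, Hf; specialize (Hkr y); lra. }
assert (Hpos : 0 < df (k y)) by (apply Hdf; specialize (Hkr y); lra).
replace (/ df (k y)) with (1 / derive_pt f (k y) (Prf (k y) Hin)) by (rewrite Hdpt; field; lra).
apply derivable_pt_lim_recip_interv; [|lra|exact Hy| |rewrite Hdpt; lra].
- apply continuity_pt_filterlim, Hkc.
- intros x Hx; apply Hid, Hx.
Qed.

(** * Self-similar solutions *)

(* The two scalar equations are the conservation laws for a function of
   [xi = x / t], the momentum one being reduced by the mass one. *)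
Definition self_similar_at (P : R -> state) (xi : R) : Prop :=
  0 < dens (P xi) /\
  exists dr du : R,
    is_derive (fun z => dens (P z)) xi dr /\ is_derive (fun z => vel (P z)) xi du /\
    (vel (P xi) - xi) * dr + dens (P xi) * du = 0 /\
    dens (P xi) * (vel (P xi) - xi) * du + w (dens (P xi)) ^ 2 * dr = 0.

Definition traces_at (P : R -> state) (xi : R) : Prop :=
  exists l r : state,
    tends_to P (at_left xi) l /\ tends_to P (at_right xi) r /\
    rankine_hugoniot k1 k2 mu xi l r.

(** Traces are demanded at every [xi], not only on [D], so that [D] may be enlarged freely; when
    profiles are glued their exceptional lists are simply concatenated. *)
Definition piecewise_solution (P : R -> state) (D : list R) : Prop :=
  (forall xi, traces_at P xi) /\ (forall xi, ~ In xi D -> self_similar_at P xi).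

Lemma tends_to_ext {T : Type} (P Q : T -> state) (F : (T -> Prop) -> Prop) (s : state) :
  Filter F -> F (fun x => P x = Q x) -> tends_to P F s -> tends_to Q F s.
Proof.
intros HF Heq [H1 H2]; split;
  [apply filterlim_ext_loc with (f := fun z => dens (P z))
  |apply filterlim_ext_loc with (f := fun z => vel (P z))];
  try assumption; apply filter_imp with (2 := Heq); intros x Hx; rewrite Hx; reflexivity.
Qed.

Lemma tends_to_const {T : Type} (P : T -> state) (F : (T -> Prop) -> Prop) (s : state) :
  Filter F -> F (fun x => P x = s) -> tends_to P F s.
Proof.
intros HF Heq; apply tends_to_ext with (P := fun _ => s); [exact HF| |].
- apply filter_imp with (2 := Heq); intros x Hx; symmetry; exact Hx.
- split; apply filterlim_const.
Qed.

Lemma self_similar_at_ext (P Q : R -> state) (xi : R) :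
  locally xi (fun z => P z = Q z) -> self_similar_at P xi -> self_similar_at Q xi.
Proof.
intros Heq [Hp [dr [du [H1 [H2 H3]]]]].
pose proof (locally_singleton _ _ Heq) as He; rewrite He in Hp, H3.
split; [exact Hp|]; exists dr, du; split; [|split; [|exact H3]].
- apply (is_derive_ext_loc (V := R_NormedModule) (fun z => dens (P z))); [|exact H1].
  apply filter_imp with (2 := Heq); intros x ->; reflexivity.
- apply (is_derive_ext_loc (V := R_NormedModule) (fun z => vel (P z))); [|exact H2].
  apply filter_imp with (2 := Heq); intros x ->; reflexivity.
Qed.

Lemma traces_at_ext (P Q : R -> state) (xi : R) :
  locally xi (fun z => P z = Q z) -> traces_at P xi -> traces_at Q xi.
Proof.
intros Heq [l [r [H1 [H2 H3]]]]; exists l, r.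
assert (HF : forall D, within D (locally xi) (fun z => P z = Q z)).
{ intros D; apply filter_imp with (2 := Heq); auto. }
split; [|split; [|exact H3]];
  (eapply tends_to_ext; [apply within_filter, locally_filter|apply HF|]);
  assumption.
Qed.

Lemma rankine_hugoniot_refl (xi : R) (s : state) : rankine_hugoniot k1 k2 mu xi s s.
Proof. split; ring. Qed.

Lemma traces_at_continuous (P : R -> state) (xi : R) :
  continuous (fun z => dens (P z)) xi -> continuous (fun z => vel (P z)) xi ->
  traces_at P xi.
Proof.
intros H1 H2; exists (P xi), (P xi).
split; [|split; [|apply rankine_hugoniot_refl]];
  (split; [apply filterlim_filter_le_1 with (2 := H1)|apply filterlim_filter_le_1 with (2 := H2)];
   apply filter_le_within).
Qed.

Lemma self_similar_at_const (s : state) (xi : R) :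
  0 < dens s -> self_similar_at (fun _ => s) xi.
Proof.
intros Hs; split; [exact Hs|]; exists 0, 0.
do 2 (split; [apply (is_derive_const (V := R_NormedModule))|]); split; ring.
Qed.

Lemma traces_at_const (s : state) (xi : R) : traces_at (fun _ => s) xi.
Proof. apply traces_at_continuous; apply continuous_const. Qed.

Lemma is_derive_momentum (r v : R -> R) (x dr dv : R) :
  is_derive r x dr -> is_derive v x dv ->
  is_derive (fun y => r y * v y) x (dr * v x + r x * dv).
Proof.
intros Hr Hv; auto_derive.
- split; [eexists; apply Hr|split; [eexists; apply Hv|trivial]].
- replace (Derive (fun y => r y) x) with dr by (symmetry; apply is_derive_unique, Hr).
  replace (Derive (fun y => v y) x) with dv by (symmetry; apply is_derive_unique, Hv).
  ring.
Qed.

(** [w ^ 2] is the derivative in the density of the total pressure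
    [- k1 / rho + k2 ^ 2 * rho ^ 2 / (2 * mu)]. *)
Lemma is_derive_momentum_flux (r v : R -> R) (x dr dv : R) :
  0 < r x -> is_derive r x dr -> is_derive v x dv ->
  is_derive (fun y => momentum_flux k1 k2 mu (State (r y) (v y))) x
    (w (r x) ^ 2 * dr + dr * v x ^ 2 + 2 * r x * v x * dv).
Proof.
intros Hpos Hr Hv.
replace (w (r x) ^ 2) with (k1 / r x ^ 2 + k2 ^ 2 * r x / mu)
  by (rewrite <- w_sqr by exact Hpos; ring).
unfold momentum_flux, pressure, magnetic; simpl; auto_derive.
- assert (ex_derive r x) by (exists dr; exact Hr).
  assert (ex_derive v x) by (exists dv; exact Hv).
  repeat split; try assumption; apply Rgt_not_eq, Hpos.
- replace (Derive (fun y => r y) x) with dr by (symmetry; apply is_derive_unique, Hr).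
  replace (Derive (fun y => v y) x) with dv by (symmetry; apply is_derive_unique, Hv).
  field; lra.
Qed.

Lemma is_derive_comp_R (f h : R -> R) (x df dh : R) :
  is_derive f (h x) df -> is_derive h x dh -> is_derive (fun y => f (h y)) x (dh * df).
Proof. exact (is_derive_comp (V := R_NormedModule) f h x df dh). Qed.

Lemma self_similar_at_satisfies_law (U : R -> state) (x t : R) :
  0 < t -> self_similar_at U (x / t) ->
  satisfies_law mass mass_flux (fun x t => U (x / t)) x t /\
  satisfies_law momentum (momentum_flux k1 k2 mu) (fun x t => U (x / t)) x t.
Proof.
intros Ht [Hd [dr [du [H1 [H2 [E1 E2]]]]]].
assert (Hx : is_derive (fun y => y / t) x (/ t)) by (auto_derive; [lra|field; lra]).
assert (Htt : is_derive (fun s => x / s) t (- x / t ^ 2)) by (auto_derive; [lra|field; lra]).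
pose proof (is_derive_comp_R _ (fun y => y / t) _ _ _ H1 Hx) as Dx.
pose proof (is_derive_comp_R _ (fun s => x / s) _ _ _ H1 Htt) as Dt.
pose proof (is_derive_comp_R _ (fun y => y / t) _ _ _ H2 Hx) as Vx.
pose proof (is_derive_comp_R _ (fun s => x / s) _ _ _ H2 Htt) as Vt.
cbv beta in Dx, Dt, Vx, Vt.
split; do 2 eexists; (split; [|split]).
- apply Dt.
- apply (is_derive_momentum _ _ _ _ _ Dx Vx).
- cbv beta; apply Rmult_eq_reg_l with t; [|lra].
  transitivity ((vel (U (x / t)) - x / t) * dr + dens (U (x / t)) * du); [field; lra|lra].
- apply (is_derive_momentum _ _ _ _ _ Dt Vt).
- apply (is_derive_momentum_flux (fun y => dens (U (y / t))) (fun y => vel (U (y / t)))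
    x _ _ Hd Dx Vx).
- cbv beta; apply Rmult_eq_reg_l with t; [|lra].
  (* After multiplication by [t], the momentum law is [vel] times the mass equation plus the reduced
     momentum equation. *)
  transitivity
    (vel (U (x / t)) * ((vel (U (x / t)) - x / t) * dr + dens (U (x / t)) * du)
     + (dens (U (x / t)) * (vel (U (x / t)) - x / t) * du + w (dens (U (x / t))) ^ 2 * dr));
    [field; lra|rewrite E1, E2; ring].
Qed.

Lemma filterlim_div_at_left (sigma t : R) : 0 < t ->
  filterlim (fun x => x / t) (at_left (sigma * t)) (at_left sigma).
Proof.
intros Ht P [eps HP]; exists (mkposreal (eps * t) (Rmult_lt_0_compat _ _ (cond_pos eps) Ht)).
intros x Hx Hlt; apply Rabs_lt_between' in Hx; simpl in Hx.
apply HP; [apply Rabs_lt_between'; split|]; unfold Rdiv;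
  apply Rmult_lt_reg_r with t; try exact Ht; field_simplify; lra.
Qed.

Lemma filterlim_div_at_right (sigma t : R) : 0 < t ->
  filterlim (fun x => x / t) (at_right (sigma * t)) (at_right sigma).
Proof.
intros Ht P [eps HP]; exists (mkposreal (eps * t) (Rmult_lt_0_compat _ _ (cond_pos eps) Ht)).
intros x Hx Hlt; apply Rabs_lt_between' in Hx; simpl in Hx.
apply HP; [apply Rabs_lt_between'; split|]; unfold Rdiv;
  apply Rmult_lt_reg_r with t; try exact Ht; field_simplify; lra.
Qed.

(** For fixed [x], letting [t] tend to 0 sends [x / t] to infinity: the initial data are read off
    the far ends of the profile. *)
Lemma at_right_0_div_lt (x M : R) : x < 0 -> at_right 0 (fun t => x / t < M).
Proof.
intros Hx.
assert (Hd : 0 < - x / (Rabs M + 1))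
  by (apply Rdiv_lt_0_compat; [|pose proof (Rabs_pos M)]; lra).
exists (mkposreal _ Hd); intros t Ht Ht0; apply Rabs_lt_between' in Ht; simpl in Ht.
assert (Hm : (Rabs M + 1) * t < - x).
{ rewrite Rmult_comm; apply Rlt_div_r; [pose proof (Rabs_pos M)|]; lra. }
apply Rlt_div_l; [exact Ht0|].
pose proof (Rle_abs (- M)) as HM; rewrite Rabs_Ropp in HM; nra.
Qed.

Lemma at_right_0_div_gt (x M : R) : 0 < x -> at_right 0 (fun t => M < x / t).
Proof.
intros Hx; apply filter_imp with (2 := at_right_0_div_lt (- x) (- M) ltac:(lra)).
intros t Ht; replace (x / t) with (- (- x / t)) by (unfold Rdiv; ring); lra.
Qed.

Lemma piecewise_solution_riemann (U : R -> state) (D : list R) (sm sp : state) :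
  piecewise_solution U D ->
  (exists M, forall xi, xi < M -> U xi = sm) ->
  (exists M, forall xi, M < xi -> U xi = sp) ->
  riemann_solution k1 k2 mu sm sp (fun x t => U (x / t)).
Proof.
intros [Htr Hss] [Mm Hm] [Mp Hp].
split; [exists D; split|split].
- intros x t Ht HD; apply self_similar_at_satisfies_law; [exact Ht|apply Hss, HD].
- intros sigma t Ht _; destruct (Htr sigma) as [l [r [Hl [Hr HRH]]]].
  exists l, r; split; [|split; [|exact HRH]].
  + split; [eapply filterlim_comp with (2 := proj1 Hl)|eapply filterlim_comp with (2 := proj2 Hl)];
      apply filterlim_div_at_left, Ht.
  + split; [eapply filterlim_comp with (2 := proj1 Hr)|eapply filterlim_comp with (2 := proj2 Hr)];
      apply filterlim_div_at_right, Ht.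
- intros x Hx; apply tends_to_const; [apply within_filter, locally_filter|].
  apply filter_imp with (2 := at_right_0_div_lt x Mm Hx); intros t; apply Hm.
- intros x Hx; apply tends_to_const; [apply within_filter, locally_filter|].
  apply filter_imp with (2 := at_right_0_div_gt x Mp Hx); intros t; apply Hp.
Qed.

(** * Elementary waves *)

(* Families of waves are indexed by a boolean, [true] for the second one. *)
Definition sgn (b : bool) : R := if b then 1 else -1.
Definition rarefaction (b : bool) : wave := if b then R2 else Defs.R1.
Definition shock (b : bool) : wave := if b then S2 else S1.

(** Rarefactions, shocks and the absent wave of one family at once. A 2-wave is parametrised from
    its right state, which is why the arguments of [wave_fun] are exchanged. *)
Definition wave_curve (b : bool) (l r : state) : Prop :=
  0 < dens l /\ 0 < dens r /\
  vel l = vel r + (if b then wave_fun (dens l) (dens r) else wave_fun (dens r) (dens l)).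

Definition wave_list (b : bool) (l r : state) : list (wave * state) :=
  if Rlt_dec 0 (sgn b * (dens r - dens l)) then (rarefaction b, r) :: nil
  else if Rlt_dec (sgn b * (dens r - dens l)) 0 then (shock b, r) :: nil
  else nil.

Local Notation connects := (connects k1 k2 mu).
Local Notation left_edge := (left_edge k1 k2 mu).
Local Notation right_edge := (right_edge k1 k2 mu).
Local Notation inside := (inside k1 k2 mu).
Local Notation fan := (fan k1 k2 mu).

Lemma sgn_cases (b : bool) : sgn b = 1 \/ sgn b = -1.
Proof. destruct b; [left|right]; reflexivity. Qed.

Lemma left_edge_rarefaction (b : bool) (l r : state) :
  left_edge (rarefaction b) l r = vel l + sgn b * w (dens l).
Proof. destruct b; simpl; unfold lambda1, lambda2; ring. Qed.

Lemma right_edge_rarefaction (b : bool) (l r : state) :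
  right_edge (rarefaction b) l r = vel r + sgn b * w (dens r).
Proof. destruct b; simpl; unfold lambda1, lambda2; ring. Qed.

Lemma left_edge_shock (b : bool) (l r : state) :
  left_edge (shock b) l r = vel l + sgn b * (dens r * g (dens r) (dens l)).
Proof. destruct b; simpl; ring. Qed.

Lemma right_edge_shock (b : bool) (l r : state) :
  right_edge (shock b) l r = left_edge (shock b) l r.
Proof. destruct b; reflexivity. Qed.

Lemma on_curve_rarefaction (b : bool) (l r : state) : 0 < dens l -> 0 < dens r ->
  on_curve k1 k2 mu (rarefaction b) l r <->
  vel r = vel l + sgn b * (wprim (dens r) - wprim (dens l)).
Proof.
intros Hl Hr; destruct b; simpl; rewrite <- wprim_minus by assumption; lra.
Qed.

Lemma on_curve_shock (b : bool) (l r : state) :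
  on_curve k1 k2 mu (shock b) l r <->
  vel r = vel l + sgn b * (g (dens r) (dens l) * (dens r - dens l)).
Proof. destruct b; simpl; lra. Qed.

Lemma wave_curve_rarefaction (b : bool) (l r : state) :
  0 <= sgn b * (dens r - dens l) ->
  wave_curve b l r <->
  0 < dens l /\ 0 < dens r /\ vel r = vel l + sgn b * (wprim (dens r) - wprim (dens l)).
Proof.
intros H; unfold wave_curve; destruct b; simpl in *; rewrite wave_fun_rarefaction by lra;
  intuition lra.
Qed.

Lemma wave_curve_shock (b : bool) (l r : state) :
  sgn b * (dens r - dens l) <= 0 ->
  wave_curve b l r <->
  0 < dens l /\ 0 < dens r /\
  vel r = vel l + sgn b * (g (dens r) (dens l) * (dens r - dens l)).
Proof.
intros H; unfold wave_curve; destruct b; simpl in *; rewrite wave_fun_shock by lra;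
  [rewrite (g_sym (dens r))|]; intuition lra.
Qed.

Lemma admissible_rarefaction (b : bool) (l r : state) :
  admissible (rarefaction b) l r <-> 0 < sgn b * (dens r - dens l).
Proof. destruct b; simpl; lra. Qed.

Lemma admissible_shock (b : bool) (l r : state) :
  admissible (shock b) l r <-> sgn b * (dens r - dens l) < 0.
Proof. destruct b; simpl; lra. Qed.

Lemma connects_rarefaction (b : bool) (l r : state) :
  connects (rarefaction b) l r <-> wave_curve b l r /\ 0 < sgn b * (dens r - dens l).
Proof.
unfold Defs.connects; rewrite admissible_rarefaction.
split.
- intros [Hl [Hr [Hc Ha]]]; rewrite on_curve_rarefaction in Hc by assumption.
  rewrite wave_curve_rarefaction by lra; tauto.
- intros [Hc Ha]; rewrite wave_curve_rarefaction in Hc by lra.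
  rewrite on_curve_rarefaction by tauto; tauto.
Qed.

Lemma connects_shock (b : bool) (l r : state) :
  connects (shock b) l r <-> wave_curve b l r /\ sgn b * (dens r - dens l) < 0.
Proof.
unfold Defs.connects; rewrite admissible_shock, on_curve_shock.
split.
- intros [Hl [Hr [Hc Ha]]]; rewrite wave_curve_shock by lra; tauto.
- intros [Hc Ha]; rewrite wave_curve_shock in Hc by lra; tauto.
Qed.

Lemma state_eq (s s' : state) : dens s = dens s' -> vel s = vel s' -> s = s'.
Proof. destruct s, s'; simpl; intros -> ->; reflexivity. Qed.

Lemma wave_curve_trivial (b : bool) (l r : state) :
  wave_curve b l r -> dens l = dens r -> l = r.
Proof.
intros Hc Hd; rewrite wave_curve_rarefaction in Hc by (rewrite Hd; lra).
apply state_eq; [exact Hd|].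
rewrite Hd in Hc; lra.
Qed.

Lemma wave_curve_refl (b : bool) (s : state) : 0 < dens s -> wave_curve b s s.
Proof. intros Hs; apply wave_curve_rarefaction; lra. Qed.

Inductive wave_list_spec (b : bool) (l r : state) : list (wave * state) -> Prop :=
| WaveListRarefaction :
    0 < sgn b * (dens r - dens l) -> connects (rarefaction b) l r ->
    wave_list_spec b l r ((rarefaction b, r) :: nil)
| WaveListShock :
    sgn b * (dens r - dens l) < 0 -> connects (shock b) l r ->
    wave_list_spec b l r ((shock b, r) :: nil)
| WaveListNil : l = r -> wave_list_spec b l r nil.

Lemma wave_listP (b : bool) (l r : state) :
  wave_curve b l r -> wave_list_spec b l r (wave_list b l r).
Proof.
intros Hc; unfold wave_list.
destruct (Rlt_dec _ _) as [H|H]; [|destruct (Rlt_dec _ _) as [H'|H']]; constructor; try assumption.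
- apply connects_rarefaction; tauto.
- apply connects_shock; tauto.
- apply (wave_curve_trivial b); [exact Hc|].
  destruct (sgn_cases b) as [E|E]; rewrite E in *; lra.
Qed.

Lemma connects_wave_list (k : wave) (l r : state) :
  connects k l r ->
  exists b, (k = rarefaction b \/ k = shock b) /\ wave_curve b l r /\
    wave_list b l r = (k, r) :: nil.
Proof.
intros Hk.
assert (Hb : exists b, k = rarefaction b \/ k = shock b)
  by (destruct k; [exists false|exists true|exists false|exists true]; simpl; tauto).
destruct Hb as [b Hb]; exists b; split; [exact Hb|].
unfold wave_list; destruct Hb as [-> | ->].
- apply connects_rarefaction in Hk; destruct Hk as [Hc Hs]; split; [exact Hc|].
  destruct (Rlt_dec _ _); [reflexivity|lra].
- apply connects_shock in Hk; destruct Hk as [Hc Hs]; split; [exact Hc|].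
  destruct (Rlt_dec _ _); [lra|destruct (Rlt_dec _ _); [reflexivity|lra]].
Qed.

Lemma rankine_hugoniot_shock (b : bool) (l r : state) :
  connects (shock b) l r -> rankine_hugoniot k1 k2 mu (left_edge (shock b) l r) l r.
Proof.
intros [Hl [Hr [Hc _]]]; apply on_curve_shock in Hc; rewrite left_edge_shock.
assert (Hs : sgn b * sgn b = 1) by (destruct (sgn_cases b) as [-> | ->]; ring).
assert (Hg := g_sqr (dens r) (dens l) Hr Hl).
unfold rankine_hugoniot, mass, mass_flux, momentum, momentum_flux, pressure, magnetic.
set (G := g (dens r) (dens l)) in *; rewrite Hc; split; [ring|].
(* This identity is the origin of [g]: the jump of total pressure equals [dens l * dens r * g ^ 2]
   times the jump of density. *)
assert (HP : - k1 / dens r + (k2 * dens r) ^ 2 / (2 * mu)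
  - (- k1 / dens l + (k2 * dens l) ^ 2 / (2 * mu))
  = dens l * dens r * ((sgn b * sgn b) * (G * G)) * (dens r - dens l))
  by (rewrite Hs, Hg; field; lra).
lra.
Qed.

Lemma char_speed_step (b : bool) (l r : state) : wave_curve b l r ->
  0 < sgn b * (dens r - dens l) ->
  left_edge (rarefaction b) l r < right_edge (rarefaction b) l r.
Proof.
intros Hc Hs; rewrite left_edge_rarefaction, right_edge_rarefaction.
rewrite wave_curve_rarefaction in Hc by lra; destruct Hc as [Hl [Hr Hv]].
rewrite Hv; destruct (sgn_cases b) as [E|E]; rewrite E in *.
- pose proof (char_fun_incr (dens l) (dens r) Hl ltac:(lra)); unfold char_fun in *; lra.
- pose proof (char_fun_incr (dens r) (dens l) Hr ltac:(lra)); unfold char_fun in *; lra.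
Qed.

(* The Lax condition. *)
Lemma shock_speed_bounds (b : bool) (l r : state) : connects (shock b) l r ->
  vel r + sgn b * w (dens r) < left_edge (shock b) l r < vel l + sgn b * w (dens l).
Proof.
intros [Hl [Hr [Hc Ha]]]; apply on_curve_shock in Hc; apply admissible_shock in Ha.
rewrite left_edge_shock, Hc.
(* The jump of velocity is the difference of the shock speeds relative to the two sides; the bound
   at [r] thus concerns [dens l * g], and the one at [l] concerns [dens r * g]. *)
replace (sgn b * (g (dens r) (dens l) * (dens r - dens l)))
  with (sgn b * (dens r * g (dens r) (dens l)) - sgn b * (dens l * g (dens r) (dens l))) by ring.
rewrite (g_sym (dens r) (dens l)) at 2.
destruct (sgn_cases b) as [E|E]; rewrite E in *.
- pose proof (mul_g_lt_w (dens r) (dens l) Hr ltac:(lra)).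
  pose proof (w_lt_mul_g (dens l) (dens r) Hr ltac:(lra)); lra.
- pose proof (mul_g_lt_w (dens l) (dens r) Hl ltac:(lra)).
  pose proof (w_lt_mul_g (dens r) (dens l) Hl ltac:(lra)); lra.
Qed.

Lemma left_le_right_edge (k : wave) (l r : state) :
  connects k l r -> left_edge k l r <= right_edge k l r.
Proof.
intros Hk; destruct (connects_wave_list k l r Hk) as [b [[-> | ->] _]].
- apply connects_rarefaction in Hk; apply Rlt_le, char_speed_step; tauto.
- rewrite right_edge_shock; lra.
Qed.

(** Behind a 1-shock [vel r] exceeds the shock speed by [dens l * g]. The velocity of the middle
    state therefore separates the two families, and the profiles are glued there. *)
Lemma right_edge_family_1 (k : wave) (l r : state) :
  connects k l r -> k = rarefaction false \/ k = shock false -> right_edge k l r < vel r.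
Proof.
intros Hk [-> | ->].
- rewrite right_edge_rarefaction; simpl sgn.
  pose proof (w_pos (dens r) (proj1 (proj2 Hk))); lra.
- rewrite right_edge_shock, left_edge_shock; destruct Hk as [Hl [Hr [Hc _]]].
  apply on_curve_shock in Hc; simpl sgn in *.
  pose proof (g_pos (dens r) (dens l) Hr Hl); nra.
Qed.

Lemma left_edge_family_2 (k : wave) (l r : state) :
  connects k l r -> k = rarefaction true \/ k = shock true -> vel l < left_edge k l r.
Proof.
intros Hk [-> | ->].
- rewrite left_edge_rarefaction; simpl sgn.
  pose proof (w_pos (dens l) (proj1 Hk)); lra.
- rewrite left_edge_shock; destruct Hk as [Hl [Hr _]]; simpl sgn.
  pose proof (g_pos (dens r) (dens l) Hr Hl); nra.
Qed.

(** * Profiles of a single wave *)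

Definition wave_profile (k : wave) (l r : state) (P : R -> state) : Prop :=
  (forall xi, xi < left_edge k l r -> P xi = l) /\
  (forall xi, left_edge k l r <= xi <= right_edge k l r -> inside k l r xi (P xi)) /\
  (forall xi, right_edge k l r < xi -> P xi = r).

Lemma shock_profile (b : bool) (l r : state) : connects (shock b) l r ->
  exists P D, wave_profile (shock b) l r P /\ piecewise_solution P D /\
    forall xi, 0 < dens (P xi).
Proof.
intros Hk; pose proof Hk as [Hl [Hr _]].
set (s := left_edge (shock b) l r).
set (P xi := if Rlt_dec xi s then l else r).
assert (HPl : forall xi, xi < s -> P xi = l)
  by (intros xi H; unfold P; destruct (Rlt_dec xi s); [reflexivity|contradiction]).
assert (HPr : forall xi, s <= xi -> P xi = r)
  by (intros xi H; unfold P; destruct (Rlt_dec xi s); [lra|reflexivity]).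
exists P, (s :: nil); split; [split; [exact HPl|split]|split; [split|]].
- intros xi _; destruct b; exact I.
- rewrite right_edge_shock; intros xi H; apply HPr, Rlt_le, H.
- intros xi; destruct (Rtotal_order xi s) as [H|[->|H]].
  + apply traces_at_ext with (fun _ => l); [|apply traces_at_const].
    apply filter_imp with (2 := open_lt s xi H); intros z Hz; symmetry; apply HPl, Hz.
  + exists l, r; split; [|split; [|apply rankine_hugoniot_shock, Hk]];
      (apply tends_to_const; [apply within_filter, locally_filter|]);
      apply (filter_forall (F := locally s)); intros z Hz; [apply HPl|apply HPr, Rlt_le]; exact Hz.
  + apply traces_at_ext with (fun _ => r); [|apply traces_at_const].
    apply filter_imp with (2 := open_gt s xi H); intros z Hz; symmetry; apply HPr, Rlt_le, Hz.
- intros xi Hxi; destruct (Rtotal_order xi s) as [H|[->|H]].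
  + apply self_similar_at_ext with (fun _ => l); [|apply self_similar_at_const, Hl].
    apply filter_imp with (2 := open_lt s xi H); intros z Hz; symmetry; apply HPl, Hz.
  + destruct Hxi; left; reflexivity.
  + apply self_similar_at_ext with (fun _ => r); [|apply self_similar_at_const, Hr].
    apply filter_imp with (2 := open_gt s xi H); intros z Hz; symmetry; apply HPr, Rlt_le, Hz.
- intros xi; unfold P; destruct (Rlt_dec xi s); assumption.
Qed.

Lemma rarefaction_profile (b : bool) (l r : state) : connects (rarefaction b) l r ->
  exists P D, wave_profile (rarefaction b) l r P /\ piecewise_solution P D /\
    forall xi, 0 < dens (P xi).
Proof.
intros Hk; pose proof Hk as [Hl [Hr [Hc Ha]]].
apply on_curve_rarefaction in Hc; [|assumption..]; apply admissible_rarefaction in Ha.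
set (e := sgn b) in *.
assert (He : e = 1 \/ e = -1) by apply sgn_cases.
assert (Hee : e * e = 1) by (destruct He as [-> | ->]; ring).
set (lo := Rmin (dens l) (dens r)); set (hi := Rmax (dens l) (dens r)).
assert (Hlo : 0 < lo <= hi).
{ split; [apply Rmin_glb_lt; assumption|].
  apply Rle_trans with (dens l); [apply Rmin_l|apply Rmax_l]. }
destruct (derive_pos_clamped_inverse char_fun _ lo hi is_derive_char_fun char_fun_derive_pos Hlo)
  as [k [Hkr [Hklo [Hkhi [Hkid [Hkc Hkd]]]]]].
(* On the curve through [l], the condition that [xi] is the characteristic speed reads [xi = vel l +
   e * (char_fun d - wprim (dens l))]; solved for [char_fun d] this is [arg xi], because
   [e * e = 1]. *)
set (arg xi := e * (xi - vel l) + wprim (dens l)).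
set (P xi := State (k (arg xi)) (vel l + e * (wprim (k (arg xi)) - wprim (dens l)))).
assert (Hpos : forall xi, 0 < k (arg xi)) by (intros xi; specialize (Hkr (arg xi)); lra).
assert (El : left_edge (rarefaction b) l r = vel l + e * (char_fun (dens l) - wprim (dens l)))
  by (rewrite left_edge_rarefaction; unfold char_fun; fold e; ring).
assert (Er : right_edge (rarefaction b) l r = vel l + e * (char_fun (dens r) - wprim (dens l)))
  by (rewrite right_edge_rarefaction, Hc; unfold char_fun; fold e; ring).
assert (HPl : forall xi, xi <= left_edge (rarefaction b) l r -> P xi = l).
{ intros xi Hxi; rewrite El in Hxi.
  assert (Hka : k (arg xi) = dens l).
  { unfold arg; destruct He as [E|E]; rewrite E in *.
    - rewrite Hklo; unfold lo; rewrite Rmin_left by lra; lra.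
    - rewrite Hkhi; unfold hi; rewrite Rmax_left by lra; lra. }
  apply state_eq; simpl; rewrite Hka; [reflexivity|ring]. }
assert (HPr : forall xi, right_edge (rarefaction b) l r <= xi -> P xi = r).
{ intros xi Hxi; rewrite Er in Hxi.
  assert (Hka : k (arg xi) = dens r).
  { unfold arg; destruct He as [E|E]; rewrite E in *.
    - rewrite Hkhi; unfold hi; rewrite Rmax_right by lra; lra.
    - rewrite Hklo; unfold lo; rewrite Rmin_right by lra; lra. }
  apply state_eq; simpl; rewrite Hka; [reflexivity|lra]. }
assert (Harg : forall xi, is_derive arg xi e)
  by (intros xi; unfold arg; auto_derive; [trivial|ring]).
assert (Hcd : forall xi, continuous (fun z => k (arg z)) xi).
{ intros xi; apply (continuous_comp arg k); [|apply Hkc].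
  apply (ex_derive_continuous (V := R_NormedModule)); exists e; apply Harg. }
exists P, (left_edge (rarefaction b) l r :: right_edge (rarefaction b) l r :: nil).
split; [split; [|split]|split; [split|]].
- intros xi H; apply HPl, Rlt_le, H.
- intros xi Hxi.
  assert (Hch : char_fun (k (arg xi)) = arg xi).
  { apply Hkid; rewrite El, Er in Hxi; unfold arg, lo, hi.
    destruct He as [E|E]; rewrite E in *;
      [rewrite Rmin_left, Rmax_right by lra|rewrite Rmin_right, Rmax_left by lra]; lra. }
  assert (Hcur : on_curve k1 k2 mu (rarefaction b) l (P xi))
    by (apply on_curve_rarefaction; simpl; auto).
  assert (Hxi' : xi = vel (P xi) + e * w (dens (P xi))).
  { simpl; replace (vel l + e * (wprim (k (arg xi)) - wprim (dens l)) + e * w (k (arg xi)))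
      with (vel l + e * (char_fun (k (arg xi)) - wprim (dens l))) by (unfold char_fun; ring).
    rewrite Hch; unfold arg.
    replace (vel l + e * (e * (xi - vel l) + wprim (dens l) - wprim (dens l)))
      with (vel l + (e * e) * (xi - vel l)) by ring.
    rewrite Hee; ring. }
  specialize (Hkr (arg xi)); unfold e, lo, hi in *; destruct b; simpl rarefaction in *; simpl sgn in *.
  + rewrite Rmin_left, Rmax_right in Hkr by lra.
    split; [unfold lambda2; lra|split; [exact Hcur|exact Hkr]].
  + rewrite Rmin_right, Rmax_left in Hkr by lra.
    split; [unfold lambda1; lra|split; [exact Hcur|exact Hkr]].
- intros xi H; apply HPr, Rlt_le, H.
- intros xi; apply traces_at_continuous; [apply Hcd|].
  apply (continuous_comp (fun z => k (arg z)) (fun d => vel l + e * (wprim d - wprim (dens l))));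
    [apply Hcd|].
  apply (ex_derive_continuous (V := R_NormedModule)).
  assert (ex_derive wprim (k (arg xi))) by (eexists; apply is_derive_wprim, Hpos).
  auto_derive; assumption.
- intros xi Hxi.
  assert (Hcases : xi < left_edge (rarefaction b) l r \/ right_edge (rarefaction b) l r < xi \/
    left_edge (rarefaction b) l r < xi < right_edge (rarefaction b) l r).
  { destruct (Rtotal_order xi (left_edge (rarefaction b) l r)) as [H|[H|H]];
      [tauto|destruct Hxi; left; auto|].
    destruct (Rtotal_order xi (right_edge (rarefaction b) l r)) as [H'|[H'|H']];
      [tauto|destruct Hxi; right; left; auto|tauto]. }
  destruct Hcases as [H|[H|H]].
  + apply self_similar_at_ext with (fun _ => l); [|apply self_similar_at_const, Hl].
    apply filter_imp with (2 := open_lt _ xi H); intros z Hz; symmetry; apply HPl, Rlt_le, Hz.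
  + apply self_similar_at_ext with (fun _ => r); [|apply self_similar_at_const, Hr].
    apply filter_imp with (2 := open_gt _ xi H); intros z Hz; symmetry; apply HPr, Rlt_le, Hz.
  + assert (Hin : char_fun lo < arg xi < char_fun hi).
    { rewrite El, Er in H; unfold arg, lo, hi.
      destruct He as [E|E]; rewrite E in *;
        [rewrite Rmin_left, Rmax_right by lra|rewrite Rmin_right, Rmax_left by lra]; lra. }
    pose proof (is_derive_comp_R k arg xi _ _ (Hkd _ Hin) (Harg xi)) as Dd; cbv beta in Dd.
    split; [apply Hpos|].
    set (d := k (arg xi)) in *.
    pose proof (is_derive_wprim d (Hpos xi)) as DW.
    set (dr := e * / (3 * (k2 ^ 2 / mu) / (2 * w d))) in *.
    exists dr, (e * (w d / d) * dr).
    assert (Hd : 0 < d) by apply Hpos.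
    (* With [xi] characteristic the two self-similar equations are proportional, and the velocity
       derivative [e * (w d / d) * dr] solves both. *)
    assert (Hv : vel (P xi) - xi = - e * w d).
    { assert (Hch : char_fun d = arg xi) by (apply Hkid; lra).
      simpl; fold d; replace (wprim d) with (arg xi - w d) by (unfold char_fun in Hch; lra).
      unfold arg.
      replace (vel l + e * (e * (xi - vel l) + wprim (dens l) - w d - wprim (dens l)) - xi)
        with ((e * e - 1) * (xi - vel l) - e * w d) by ring.
      rewrite Hee; ring. }
    rewrite Hv; simpl dens; fold d.
    split; [exact Dd|split; [|split]].
    * pose proof (is_derive_comp_R wprim (fun z => k (arg z)) xi _ _ DW Dd) as DWk.
      replace (e * (w d / d) * dr) with (0 + e * (dr * (w d / d) - 0)) by ring.
      apply (is_derive_plus (V := R_NormedModule) (fun _ => vel l)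
        (fun z => e * (wprim (k (arg z)) - wprim (dens l)))).
      { apply (is_derive_const (V := R_NormedModule)). }
      apply is_derive_scal.
      apply (is_derive_minus (V := R_NormedModule) (fun z => wprim (k (arg z))) (fun _ => wprim (dens l))).
      { exact DWk. }
      apply (is_derive_const (V := R_NormedModule)).
    * field; lra.
    * replace (d * (- e * w d) * (e * (w d / d) * dr) + w d ^ 2 * dr)
        with ((1 - e * e) * (w d ^ 2 * dr)) by (field; lra).
      rewrite Hee; ring.
- intros xi; apply Hpos.
Qed.

Lemma wave_curve_profile (b : bool) (l r : state) : wave_curve b l r ->
  exists P D, piecewise_solution P D /\ (forall xi, 0 < dens (P xi)) /\
    (l = r -> forall xi, P xi = l) /\
    (forall k, connects k l r -> k = rarefaction b \/ k = shock b -> wave_profile k l r P).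
Proof.
intros Hc; pose proof (wave_listP b l r Hc) as Hspec; inversion Hspec as [Hs Hk E|Hs Hk E|He E].
- destruct (rarefaction_profile b l r Hk) as [P [D [HP [HD Hpos]]]].
  exists P, D; split; [exact HD|split; [exact Hpos|split]].
  + intros ->; exfalso; lra.
  + intros k Hk' [-> | ->]; [exact HP|apply connects_shock in Hk'; exfalso; lra].
- destruct (shock_profile b l r Hk) as [P [D [HP [HD Hpos]]]].
  exists P, D; split; [exact HD|split; [exact Hpos|split]].
  + intros ->; exfalso; lra.
  + intros k Hk' [-> | ->]; [apply connects_rarefaction in Hk'; exfalso; lra|exact HP].
- exists (fun _ => l), nil; split; [split|split; [|split]].
  + apply traces_at_const.
  + intros xi _; apply self_similar_at_const, Hc.
  + intros _; apply Hc.
  + reflexivity.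
  + intros k Hk [-> | ->]; exfalso.
    * apply connects_rarefaction in Hk; subst r; lra.
    * apply connects_shock in Hk; subst r; lra.
Qed.

(** * Existence *)

Lemma middle_state_exists (l r : state) : 0 < dens l -> 0 < dens r ->
  exists m, wave_curve false l m /\ wave_curve true m r.
Proof.
intros Hl Hr.
(* The two wave curves give [vel m] as [vel l - wave_fun a (dens l)] and as
   [vel r + wave_fun a (dens r)]; equating them gives the right-hand side [vel l - vel r]. *)
destruct (wave_fun_pair_surj (dens l) (dens r) (vel l - vel r) Hl Hr) as [a [Ha H]].
exists (State a (vel r + wave_fun a (dens r))); unfold wave_curve; simpl.
repeat split; lra.
Qed.

Lemma middle_state_unique (l m m' r : state) :
  wave_curve false l m -> wave_curve true m r ->
  wave_curve false l m' -> wave_curve true m' r -> m = m'.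
Proof.
intros [Hl [Hm Hv]] [_ [Hr Hv2]] [_ [Hm' Hv']] [_ [_ Hv2']]; simpl in *.
assert (Hd : dens m = dens m')
  by (apply (wave_fun_pair_inj (dens l) (dens r)); try assumption; lra).
apply state_eq; [exact Hd|rewrite Hd in *; lra].
Qed.

(** The start [e] is kept general because it is either the right edge of a 1-wave or, when that wave
    is absent, minus infinity. *)
Lemma fan_wave_list_2 (U : R -> state) (e : Rbar) (m r : state) :
  wave_curve true m r -> Rbar_lt e (vel m) ->
  (m = r -> forall xi : R, Rbar_lt e xi -> U xi = m) ->
  (forall k, connects k m r -> k = rarefaction true \/ k = shock true ->
     (forall xi : R, Rbar_lt e xi -> xi < left_edge k m r -> U xi = m) /\
     (forall xi, left_edge k m r <= xi <= right_edge k m r -> inside k m r xi (U xi)) /\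
     (forall xi, right_edge k m r < xi -> U xi = r)) ->
  fan U r e m (wave_list true m r).
Proof.
intros Hc He Hnil Hcons.
assert (Hone : forall k, connects k m r -> k = rarefaction true \/ k = shock true ->
  fan U r e m ((k, r) :: nil)).
{ intros k Hk Hb; destruct (Hcons k Hk Hb) as [H1 [H2 H3]].
  pose proof (left_edge_family_2 k m r Hk Hb) as Hle.
  split; [exact Hk|split; [|split; [exact H1|split; [exact H2|split; [reflexivity|exact H3]]]]].
  apply Rbar_lt_le, Rbar_lt_trans with (1 := He); exact Hle. }
destruct (wave_listP true m r Hc) as [Hs Hk|Hs Hk|Hs]; [apply Hone; auto|apply Hone; auto|].
split; [exact Hs|exact (Hnil Hs)].
Qed.

Lemma entropy_solution_exists (l r : state) : 0 < dens l -> 0 < dens r ->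
  exists U, entropy_solution k1 k2 mu l r U.
Proof.
intros Hl Hr.
destruct (middle_state_exists l r Hl Hr) as [m [C1 C2]].
destruct (wave_curve_profile false l m C1) as [P1 [D1 [[T1 S1] [Q1 [N1 W1]]]]].
destruct (wave_curve_profile true m r C2) as [P2 [D2 [[T2 S2] [Q2 [N2 W2]]]]].
(* Below, [c] and [d] enclose [vel m] and both profiles equal [m] between them, so [U] agrees with
   [P1] before [d] and with [P2] after [c]. *)
set (U xi := if Rle_dec xi (vel m) then P1 xi else P2 xi).
assert (M1 : exists c, c < vel m /\ (exists M, forall xi, xi < M -> P1 xi = l) /\
  forall xi, c < xi -> P1 xi = m).
{ destruct (wave_listP false l m C1) as [Hs Hk|Hs Hk|Hs].
  - destruct (W1 _ Hk ltac:(auto)) as [HL [_ HR]].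
    eexists; split; [apply (right_edge_family_1 _ _ _ Hk); auto|].
    split; [eexists; exact HL|exact HR].
  - destruct (W1 _ Hk ltac:(auto)) as [HL [_ HR]].
    eexists; split; [apply (right_edge_family_1 _ _ _ Hk); auto|].
    split; [eexists; exact HL|exact HR].
  - exists (vel m - 1); split; [lra|]; rewrite <- Hs.
    split; [exists 0|]; intros xi _; apply (N1 Hs). }
assert (M2 : exists d, vel m < d /\ (exists M, forall xi, M < xi -> P2 xi = r) /\
  forall xi, xi < d -> P2 xi = m).
{ destruct (wave_listP true m r C2) as [Hs Hk|Hs Hk|Hs].
  - destruct (W2 _ Hk ltac:(auto)) as [HL [_ HR]].
    eexists; split; [apply (left_edge_family_2 _ _ _ Hk); auto|].
    split; [eexists; exact HR|exact HL].
  - destruct (W2 _ Hk ltac:(auto)) as [HL [_ HR]].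
    eexists; split; [apply (left_edge_family_2 _ _ _ Hk); auto|].
    split; [eexists; exact HR|exact HL].
  - exists (vel m + 1); split; [lra|]; rewrite <- Hs.
    split; [exists 0|]; intros xi _; apply (N2 Hs). }
destruct M1 as [c [Hc [[ML HML] HP1]]], M2 as [d [Hd [[MR HMR] HP2]]].
assert (HU1 : forall xi, xi < d -> P1 xi = U xi).
{ intros xi Hxi; unfold U; destruct (Rle_dec xi (vel m)); [reflexivity|].
  rewrite HP1, HP2 by lra; reflexivity. }
assert (HU2 : forall xi, c < xi -> P2 xi = U xi).
{ intros xi Hxi; unfold U; destruct (Rle_dec xi (vel m)); [|reflexivity].
  rewrite HP1, HP2 by lra; reflexivity. }
assert (HD : piecewise_solution U (D1 ++ D2)).
{ assert (Hloc : forall xi, locally xi (fun z => P1 z = U z) \/ locally xi (fun z => P2 z = U z)).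
  { intros xi; destruct (Rlt_le_dec xi d) as [H|H].
    - left; apply filter_imp with (2 := open_lt d xi H); exact HU1.
    - right; apply filter_imp with (2 := open_gt c xi ltac:(lra)); exact HU2. }
  split.
  - intros xi; destruct (Hloc xi) as [H|H];
      [apply traces_at_ext with (1 := H), T1|apply traces_at_ext with (1 := H), T2].
  - intros xi Hxi; destruct (Hloc xi) as [H|H];
      [apply self_similar_at_ext with (1 := H), S1|apply self_similar_at_ext with (1 := H), S2];
      intros Hin; apply Hxi, in_or_app; tauto. }
assert (HM : exists M, forall xi, xi < M -> U xi = l).
{ exists (Rmin ML d); intros xi Hxi.
  rewrite <- HU1 by (apply Rlt_le_trans with (1 := Hxi), Rmin_r).
  apply HML, Rlt_le_trans with (1 := Hxi), Rmin_l. }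
assert (HM' : exists M, forall xi, M < xi -> U xi = r).
{ exists (Rmax MR c); intros xi Hxi.
  rewrite <- HU2 by (apply Rle_lt_trans with (2 := Hxi), Rmax_r).
  apply HMR, Rle_lt_trans with (2 := Hxi), Rmax_l. }
exists U; split; [|split; [|split; [|split]]].
- intros xi; unfold U; destruct (Rle_dec xi (vel m)); [apply Q1|apply Q2].
- apply tends_to_const; [apply Rbar_locally_filter|exact HM].
- apply tends_to_const; [apply Rbar_locally_filter|exact HM'].
- exact (piecewise_solution_riemann U _ l r HD HM HM').
- exists (wave_list false l m ++ wave_list true m r).
  assert (Hfan2 : forall e : Rbar, Rbar_lt e (vel m) ->
    (forall xi : R, Rbar_lt e xi -> P2 xi = U xi) -> fan U r e m (wave_list true m r)).
  { intros e He HeU; apply fan_wave_list_2; try assumption.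
    - intros Hmr xi Hxi; rewrite <- HeU by exact Hxi; apply (N2 Hmr).
    - intros k Hk Hb; destruct (W2 k Hk Hb) as [H1 [H2 H3]].
      pose proof (left_edge_family_2 k m r Hk Hb) as Hle.
      pose proof (left_le_right_edge k m r Hk) as Hlr.
      split; [|split].
      + intros xi Hxi Hxi'; rewrite <- HeU by exact Hxi; apply H1, Hxi'.
      + intros xi Hxi; rewrite <- HU2 by lra; apply H2, Hxi.
      + intros xi Hxi; rewrite <- HU2 by lra; apply H3, Hxi. }
  assert (Hone : forall k, connects k l m -> k = rarefaction false \/ k = shock false ->
    fan U r m_infty l (((k, m) :: nil) ++ wave_list true m r)).
  { intros k Hk Hb; destruct (W1 k Hk Hb) as [H1 [H2 H3]].
    pose proof (right_edge_family_1 k l m Hk Hb) as Hlt.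
    pose proof (left_le_right_edge k l m Hk) as Hlr.
    split; [exact Hk|split; [exact I|split; [|split]]].
    - intros xi _ Hxi; rewrite <- HU1 by lra; apply H1, Hxi.
    - intros xi Hxi; rewrite <- HU1 by lra; apply H2, Hxi.
    - apply Hfan2; [exact Hlt|].
      intros xi Hxi; simpl in Hxi; destruct (Rlt_le_dec xi d) as [H|H].
      + rewrite <- HU1 by exact H; rewrite H3, HP2 by assumption; reflexivity.
      + apply HU2; lra. }
  destruct (wave_listP false l m C1) as [Hs Hk|Hs Hk|Hs]; [apply Hone; auto|apply Hone; auto|].
  simpl; rewrite Hs; apply Hfan2; [exact I|].
  intros xi _; destruct (Rlt_le_dec xi d) as [H|H]; [|apply HU2; lra].
  rewrite <- HU1 by exact H; rewrite (N1 Hs), Hs; apply HP2, H.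
Qed.

(** * Uniqueness *)

(* By the Lax condition a shock is separated from the characteristics of its own
   family on both sides, hence cannot abut another wave of that family. *)
Lemma wave_order (k k' : wave) (l m r : state) :
  connects k l m -> connects k' m r -> right_edge k l m <= left_edge k' m r ->
  (k = rarefaction false \/ k = shock false) /\ (k' = rarefaction true \/ k' = shock true) \/
  exists b, k = rarefaction b /\ k' = rarefaction b.
Proof.
intros Hk Hk' Hle.
destruct (connects_wave_list k l m Hk) as [b [Hb _]].
destruct (connects_wave_list k' m r Hk') as [b' [Hb' _]].
pose proof (w_pos (dens m) (proj1 Hk')) as Hw.
assert (Hright : k = rarefaction b /\ right_edge k l m = vel m + sgn b * w (dens m) \/
  k = shock b /\ vel m + sgn b * w (dens m) < right_edge k l m).
{ destruct Hb as [-> | ->]; [left|right]; (split; [reflexivity|]).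
  - apply right_edge_rarefaction.
  - rewrite right_edge_shock; apply shock_speed_bounds, Hk. }
assert (Hleft : k' = rarefaction b' /\ left_edge k' m r = vel m + sgn b' * w (dens m) \/
  k' = shock b' /\ left_edge k' m r < vel m + sgn b' * w (dens m)).
{ destruct Hb' as [-> | ->]; [left|right]; (split; [reflexivity|]).
  - apply left_edge_rarefaction.
  - apply shock_speed_bounds, Hk'. }
(* A 2-wave cannot precede a 1-wave: its right edge is at least [vel m + w (dens m)], while the left
   edge of the other is at most [vel m - w (dens m)]. Within one family, the strict inequality on
   the side of a shock contradicts the ordering. *)
destruct b, b'; simpl sgn in *.
- right; exists true; destruct Hright as [[-> Er]|[-> Er]], Hleft as [[-> El]|[-> El]];
    try (exfalso; lra); split; reflexivity.
- exfalso; lra.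
- left; split; assumption.
- right; exists false; destruct Hright as [[-> Er]|[-> Er]], Hleft as [[-> El]|[-> El]];
    try (exfalso; lra); split; reflexivity.
Qed.

(** On one rarefaction curve the characteristic speed is a constant plus [sgn b * char_fun]; applied
    in both directions, this shows that [xi] determines the state. *)
Lemma rarefaction_states_monotone (b : bool) (l s t : state) :
  0 < dens l -> 0 < dens s -> 0 < dens t ->
  on_curve k1 k2 mu (rarefaction b) l s -> on_curve k1 k2 mu (rarefaction b) l t ->
  vel s + sgn b * w (dens s) <= vel t + sgn b * w (dens t) ->
  sgn b * dens s <= sgn b * dens t.
Proof.
intros Hl Hs Ht Cs Ct Hle.
apply on_curve_rarefaction in Cs; [|assumption..].
apply on_curve_rarefaction in Ct; [|assumption..].
apply Rnot_lt_le; intros Hlt.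
destruct (sgn_cases b) as [E|E]; rewrite E in *.
- pose proof (char_fun_incr (dens t) (dens s) Ht ltac:(lra)); unfold char_fun in *; lra.
- pose proof (char_fun_incr (dens s) (dens t) Hs ltac:(lra)); unfold char_fun in *; lra.
Qed.

Lemma inside_rarefaction (b : bool) (l r s : state) (xi : R) :
  inside (rarefaction b) l r xi s <->
  xi = vel s + sgn b * w (dens s) /\ on_curve k1 k2 mu (rarefaction b) l s /\
  sgn b * dens l <= sgn b * dens s <= sgn b * dens r.
Proof. destruct b; simpl; unfold lambda1, lambda2; intuition lra. Qed.

Lemma inside_rarefaction_pos (b : bool) (l r s : state) (xi : R) :
  connects (rarefaction b) l r -> inside (rarefaction b) l r xi s -> 0 < dens s.
Proof. intros [Hl [Hr _]] H; destruct b; simpl in H; lra. Qed.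

Lemma inside_rarefaction_unique (b : bool) (l r s t : state) (xi : R) :
  connects (rarefaction b) l r -> inside (rarefaction b) l r xi s ->
  inside (rarefaction b) l r xi t -> s = t.
Proof.
intros Hk Hs Ht.
pose proof (inside_rarefaction_pos _ _ _ _ _ Hk Hs) as Ps.
pose proof (inside_rarefaction_pos _ _ _ _ _ Hk Ht) as Pt.
apply inside_rarefaction in Hs; apply inside_rarefaction in Ht.
destruct Hs as [Es [Cs _]], Ht as [Et [Ct _]].
pose proof (rarefaction_states_monotone b l s t (proj1 Hk) Ps Pt Cs Ct ltac:(lra)).
pose proof (rarefaction_states_monotone b l t s (proj1 Hk) Pt Ps Ct Cs ltac:(lra)).
assert (Hd : dens s = dens t)
  by (destruct (sgn_cases b) as [E|E]; rewrite E in *; lra).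
apply state_eq; [exact Hd|rewrite Hd in *; lra].
Qed.

(** Both edges at [m] equal its characteristic speed, so no constant zone lies between the fans, and
    additivity of the integral places the states of the second fan on the curve through [l]. *)
Lemma fan_merge_rarefactions (U : R -> state) (last : state) (e : Rbar) (b : bool)
    (l m r : state) (ws : list (wave * state)) :
  fan U last e l ((rarefaction b, m) :: (rarefaction b, r) :: ws) ->
  fan U last e l ((rarefaction b, r) :: ws).
Proof.
intros [Hk [He [Hl [Hin [Hk' [Hle [Hm [Hin' Hfan]]]]]]]].
pose proof Hk as [Hpl [Hpm [Hc Ha]]]; pose proof Hk' as [_ [Hpr [Hc' Ha']]].
apply on_curve_rarefaction in Hc; [|assumption..].
apply on_curve_rarefaction in Hc'; [|assumption..].
apply admissible_rarefaction in Ha; apply admissible_rarefaction in Ha'.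
assert (Hcon : connects (rarefaction b) l r).
{ split; [exact Hpl|split; [exact Hpr|split]].
  - apply on_curve_rarefaction; [assumption..|rewrite Hc', Hc; ring].
  - apply admissible_rarefaction.
    replace (sgn b * (dens r - dens l))
      with (sgn b * (dens m - dens l) + sgn b * (dens r - dens m)) by ring; lra. }
assert (Hel : left_edge (rarefaction b) l r = left_edge (rarefaction b) l m)
  by (rewrite !left_edge_rarefaction; reflexivity).
assert (Her : right_edge (rarefaction b) l r = right_edge (rarefaction b) m r)
  by (rewrite !right_edge_rarefaction; reflexivity).
assert (Hmid : right_edge (rarefaction b) l m = left_edge (rarefaction b) m r)
  by (rewrite left_edge_rarefaction, right_edge_rarefaction; reflexivity).
split; [exact Hcon|]; rewrite Hel, Her.
split; [exact He|split; [exact Hl|split; [|exact Hfan]]].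
intros xi Hxi; destruct (Rle_lt_dec xi (right_edge (rarefaction b) l m)) as [H|H].
- specialize (Hin xi ltac:(lra)); apply inside_rarefaction in Hin; apply inside_rarefaction.
  split; [apply Hin|split; [apply Hin|]].
  destruct Hin as [_ [_ Hin]]; lra.
- specialize (Hin' xi ltac:(lra)); pose proof (inside_rarefaction_pos _ _ _ _ _ Hk' Hin') as Hp.
  apply inside_rarefaction in Hin'; apply inside_rarefaction.
  destruct Hin' as [Hx [Hcx Hd]]; split; [exact Hx|split; [|lra]].
  apply on_curve_rarefaction in Hcx; [|assumption..].
  apply on_curve_rarefaction; [assumption..|rewrite Hcx, Hc; ring].
Qed.

Lemma family_wave_list (k : wave) (b : bool) (l r : state) :
  connects k l r -> k = rarefaction b \/ k = shock b ->
  wave_curve b l r /\ wave_list b l r = (k, r) :: nil.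
Proof.
intros Hk Hb; destruct (connects_wave_list k l r Hk) as [b' [Hb' H]].
replace b with b'; [exact H|].
destruct b, b', Hb as [-> | ->], Hb' as [Hb' | Hb']; try discriminate Hb'; reflexivity.
Qed.

Lemma wave_list_refl (b : bool) (s : state) : wave_list b s s = nil.
Proof.
unfold wave_list; replace (sgn b * (dens s - dens s)) with 0 by ring.
destruct (Rlt_dec 0 0); [lra|reflexivity].
Qed.

(* Consecutive rarefactions of one family share the characteristic through their
   common state; they are merged into a single wave. *)
Lemma fan_normal_form (U : R -> state) (last : state) (ws : list (wave * state)) :
  forall (e : Rbar) (l : state), 0 < dens l -> fan U last e l ws ->
  exists m, wave_curve false l m /\ wave_curve true m last /\
    fan U last e l (wave_list false l m ++ wave_list true m last).
Proof.
induction ws as [|[k r] ws IH]; intros e l Hl Hfan.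
- destruct Hfan as [<- HU]; exists l; rewrite !wave_list_refl.
  split; [apply wave_curve_refl, Hl|split; [apply wave_curve_refl, Hl|]].
  split; [reflexivity|exact HU].
- destruct Hfan as [Hk [He [HU [Hin Hfan]]]].
  destruct (IH _ r (proj1 (proj2 Hk)) Hfan) as [m [C1 [C2 Hn]]].
  assert (Hcons : fan U last e l ((k, r) :: wave_list false r m ++ wave_list true m last))
    by (do 4 (split; [assumption|]); exact Hn).
  clear IH Hfan ws HU Hin.
  (* The normalised tail starts with a 1-wave: the order of waves then forces the head to be a
     1-rarefaction too, and merging keeps the middle state [m]. *)
  assert (H1 : forall k', connects k' r m -> k' = rarefaction false \/ k' = shock false ->
    wave_list false r m = (k', m) :: nil ->
    exists m, wave_curve false l m /\ wave_curve true m last /\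
      fan U last e l (wave_list false l m ++ wave_list true m last)).
  { intros k' Hk' Hb' E; rewrite E in Hcons, Hn.
    destruct Hn as [_ [Hle _]].
    destruct (wave_order _ _ _ _ _ Hk Hk' Hle) as [[_ [-> | ->]]|[b [-> ->]]];
      [destruct Hb'; discriminate..|].
    destruct b; [destruct Hb'; discriminate|].
    apply fan_merge_rarefactions in Hcons.
    destruct (family_wave_list _ false _ _ (proj1 Hcons) ltac:(auto)) as [Hc Hw].
    exists m; rewrite Hw; auto. }
  destruct (wave_listP false r m C1) as [Hs Hk'|Hs Hk'|Hs];
    [eapply H1; eauto; apply family_wave_list; auto..|subst m].
  (* The tail is a single 2-wave: either the head is a 1-wave and [r] is the middle state, or both
     are 2-rarefactions, which merge and leave [l] as middle state. *)
  assert (H2 : forall k', connects k' r last -> k' = rarefaction true \/ k' = shock true ->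
    wave_list true r last = (k', last) :: nil ->
    exists m, wave_curve false l m /\ wave_curve true m last /\
      fan U last e l (wave_list false l m ++ wave_list true m last)).
  { intros k' Hk' Hb' E; rewrite app_nil_l, E in Hcons, Hn.
    destruct Hn as [_ [Hle _]].
    destruct (wave_order _ _ _ _ _ Hk Hk' Hle) as [[Hb _]|[[|] [-> ->]]];
      [| |destruct Hb'; discriminate].
    - destruct (family_wave_list _ false _ _ Hk Hb) as [Hc Hw].
      exists r; rewrite Hw, E; auto.
    - apply fan_merge_rarefactions in Hcons.
      destruct (family_wave_list _ true _ _ (proj1 Hcons) ltac:(auto)) as [Hc Hw].
      exists l; rewrite Hw, wave_list_refl; auto using wave_curve_refl. }
  destruct (wave_listP true r last C2) as [Hs Hk'|Hs Hk'|Hs];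
    [eapply H2; eauto; apply family_wave_list; auto..|].
  (* The head is the only wave; its family decides whether the middle state is [l] or [last]. *)
  destruct (connects_wave_list k l r Hk) as [[|] [Hb [Hc Hw]]]; subst last.
  + exists l; rewrite Hw, wave_list_refl; auto using wave_curve_refl.
  + exists r; rewrite Hw, wave_list_refl; auto using wave_curve_refl.
Qed.

(* [fan] allows an intermediate constant state of zero width; its presence would
   hide a jump, so agreement off the jumps needs strict inequalities. *)
Fixpoint separated (e : Rbar) (l : state) (ws : list (wave * state)) : Prop :=
  match ws with
  | nil => True
  | (k, r) :: ws' => Rbar_lt e (left_edge k l r) /\ separated (right_edge k l r) r ws'
  end.

Lemma wave_lists_separated (l m r : state) :
  wave_curve false l m -> wave_curve true m r ->
  separated m_infty l (wave_list false l m ++ wave_list true m r).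
Proof.
intros C1 C2.
assert (H2 : forall e : Rbar, Rbar_lt e (vel m) -> separated e m (wave_list true m r)).
{ intros e He; destruct (wave_listP true m r C2) as [Hs Hk|Hs Hk|Hs]; [| |exact I];
    (split; [|exact I]); apply Rbar_lt_trans with (1 := He);
    apply (left_edge_family_2 _ _ _ Hk); auto. }
destruct (wave_listP false l m C1) as [Hs Hk|Hs Hk|Hs].
- split; [exact I|]; apply H2, (right_edge_family_1 _ _ _ Hk); auto.
- split; [exact I|]; apply H2, (right_edge_family_1 _ _ _ Hk); auto.
- rewrite Hs; apply H2; exact I.
Qed.

Lemma fan_start_const (U : R -> state) (last l : state) (e : R) (ws : list (wave * state)) :
  fan U last e l ws -> separated e l ws ->
  exists d, e < d /\ forall xi, e < xi < d -> U xi = l.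
Proof.
intros Hfan Hsep; destruct ws as [|[k r] ws].
- exists (e + 1); split; [lra|]; intros xi Hxi; apply Hfan; simpl; lra.
- exists (left_edge k l r); split; [apply Hsep|].
  intros xi Hxi; apply Hfan; simpl; lra.
Qed.

(** The value at [s] is the limit from either side, whatever was chosen there; uniqueness of limits
    identifies the two densities. *)
Lemma jump_not_continuous (U : R -> state) (c s d : R) (l r : state) :
  c < s < d -> (forall xi, c < xi < s -> U xi = l) -> (forall xi, s < xi < d -> U xi = r) ->
  tends_to U (locally s) (U s) -> dens l = dens r.
Proof.
intros Hs Hl Hr [Hc _].
assert (HL : dens l = dens (U s)).
{ apply (filterlim_locally_unique (F := at_left s) (fun z => dens (U z))).
  - apply tends_to_const; [apply within_filter, locally_filter|].
    apply filter_imp with (2 := open_gt c s (proj1 Hs)); intros z Hz Hzs; apply Hl; lra.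
  - apply filterlim_filter_le_1 with (2 := Hc), filter_le_within. }
assert (HR : dens r = dens (U s)).
{ apply (filterlim_locally_unique (F := at_right s) (fun z => dens (U z))).
  - apply tends_to_const; [apply within_filter, locally_filter|].
    apply filter_imp with (2 := open_lt d s (proj2 Hs)); intros z Hz Hzs; apply Hr; lra.
  - apply filterlim_filter_le_1 with (2 := Hc), filter_le_within. }
congruence.
Qed.

(** Constant states and rarefactions force the value. At a shock, [separated] leaves a constant
    state on each side, so continuity of [U] would contradict admissibility; since [V] follows the
    same list, its jumps sit at the same places. *)
Lemma fan_agree (U V : R -> state) (last : state) (ws : list (wave * state)) :
  forall (e : Rbar) (l : state),
  fan U last e l ws -> fan V last e l ws -> separated e l ws ->
  forall xi : R, Rbar_lt e xi -> tends_to U (locally xi) (U xi) -> U xi = V xi.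
Proof.
induction ws as [|[k r] ws IH]; intros e l HU HV Hsep xi Hxi Hcont.
- destruct HU as [_ HU], HV as [_ HV]; rewrite HU, HV by exact Hxi; reflexivity.
- destruct HU as [Hk [_ [HUl [HUi HUf]]]], HV as [_ [_ [HVl [HVi HVf]]]].
  destruct Hsep as [Hlt Hsep].
  destruct (Rlt_le_dec xi (left_edge k l r)) as [H|H];
    [rewrite HUl, HVl by assumption; reflexivity|].
  destruct (Rlt_le_dec (right_edge k l r) xi) as [H'|H'];
    [apply (IH (right_edge k l r) r); assumption|].
  destruct (connects_wave_list k l r Hk) as [b [[-> | ->] _]].
  + apply (inside_rarefaction_unique b l r _ _ xi Hk); [apply HUi|apply HVi]; lra.
  + exfalso; rewrite right_edge_shock in *.
    assert (xi = left_edge (shock b) l r) by lra; subst xi.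
    destruct (fan_start_const _ _ _ _ _ HUf Hsep) as [d [Hd HUd]].
    assert (Hc : exists c, c < left_edge (shock b) l r /\
      forall z, c < z < left_edge (shock b) l r -> U z = l).
    { destruct e as [e| |]; [exists e|contradiction|exists (left_edge (shock b) l r - 1)];
        (split; [simpl in *; lra|]); intros z Hz; apply HUl; simpl; try exact I; lra. }
    destruct Hc as [c [Hc HUc]].
    pose proof (jump_not_continuous U c _ d l r (conj Hc Hd) HUc HUd Hcont) as E.
    apply connects_shock in Hk; rewrite E in Hk; lra.
Qed.

Lemma composed_of_waves_unique (l r : state) (U V : R -> state) : 0 < dens l ->
  composed_of_waves k1 k2 mu l r U -> composed_of_waves k1 k2 mu l r V ->
  forall xi : R, tends_to U (locally xi) (U xi) -> U xi = V xi.
Proof.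
intros Hl [ws HU] [ws' HV] xi.
destruct (fan_normal_form U r ws m_infty l Hl HU) as [m [C1 [C2 NU]]].
destruct (fan_normal_form V r ws' m_infty l Hl HV) as [m' [C1' [C2' NV]]].
(* With equal middle states both normal forms are literally the same list, as [wave_list] depends
   only on the states. *)
rewrite <- (middle_state_unique l m m' r C1 C2 C1' C2') in NV.
apply (fan_agree U V r _ m_infty l NU NV); [apply wave_lists_separated; assumption|exact I].
Qed.

End Chaplygin.

Theorem theorem1 (mu k1 k2 rho_m rho_p u_m u_p : R)
    (Hmu : 0 < mu) (Hk1 : 0 < k1) (Hk2 : 0 < k2)
    (Hrho_m : 0 < rho_m) (Hrho_p : 0 < rho_p) :
  (exists U : R -> state,
     entropy_solution k1 k2 mu (State rho_m u_m) (State rho_p u_p) U /\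
     composed_of_waves k1 k2 mu (State rho_m u_m) (State rho_p u_p) U) /\
  (forall U V : R -> state,
     entropy_solution k1 k2 mu (State rho_m u_m) (State rho_p u_p) U ->
     entropy_solution k1 k2 mu (State rho_m u_m) (State rho_p u_p) V ->
     forall xi : R, tends_to U (locally xi) (U xi) -> U xi = V xi).
Proof.
split.
- destruct (entropy_solution_exists k1 k2 mu Hmu Hk1 Hk2 (State rho_m u_m) (State rho_p u_p)
    Hrho_m Hrho_p) as [U HU].
  exists U; split; [exact HU|apply HU].
- intros U V HU HV.
  apply (composed_of_waves_unique k1 k2 mu Hmu Hk1 Hk2 (State rho_m u_m) (State rho_p u_p) U V
    Hrho_m); [apply HU|apply HV].
Qed.
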